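(* For all integers $n\ge 0$, $$c\phi_{16}(4n+3)\equiv 0\pmod{1024},\qquad c\phi_{16}(8n+7)\equiv 0\pmod{2048}.$$
   Context: For a positive integer $k$ and an integer $n\ge 0$, $c\phi_k(n)$ denotes the number of $k$-colored generalized Frobenius partitions of $n$ (Andrews): two-rowed arrays $\begin{pmatrix} a_1 & a_2 & \cdots & a_r\\ b_1 & b_2 & \cdots & b_r\end{pmatrix}$ (with $r\ge 0$) in which every entry is a non-negative integer carrying one of $k$ colors, no integer occurs twice in the same color in the same row, each row is arranged in non-increasing order (equal integers being ordered by a fixed order on colors, so that a row is just a set of $r$ colored non-negative integers), and $n=r+\sum_{j=1}^r(a_j+b_j)$ (colors do not contribute to the sum). Equivalently, $\sum_{n\ge0}c\phi_k(n)q^n$ is the coefficient of $z^0$ in $\prod_{j\ge 0}(1+zq^{j+1})^k(1+z^{-1}q^{j})^k$. *)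

(* Defs.v *)
From mathcomp Require Import all_boot.

Set Implicit Arguments.
Unset Strict Implicit.
Unset Printing Implicit Defensive.

(* The pair (i, c) is the integer i carrying the color c. A row is determined
   by the set of its colored entries, so an array is a pair of sets of the same
   cardinality. *)
Definition crow (k N : nat) := {set 'I_N * 'I_k}.

Definition crow_sum (k N : nat) (A : crow k N) : nat := \sum_(x in A) (x.1 : nat).

(* k-colored generalized Frobenius partitions of n with entries less than N. *)
Definition gfrob (k N n : nat) : {set crow k N * crow k N} :=
  [set AB : crow k N * crow k N |
     (#|AB.1| == #|AB.2|) && (n == #|AB.1| + (crow_sum AB.1 + crow_sum AB.2))].

(* The bound N = n loses nothing: see gfrob_entry_lt. *)
Definition cphi (k n : nat) : nat := #|gfrob k n n|.

Lemma gfrob_entry_lt (k N n : nat) (AB : crow k N * crow k N) (x : 'I_N * 'I_k) :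
  AB \in gfrob k N n -> x \in AB.1 :|: AB.2 -> x.1 < n.
Proof.
case: AB => A B; rewrite !inE /= => /andP[/eqP eqAB /eqP ->].
have row_bound (C : crow k N) : x \in C -> x.1 < #|C| + crow_sum C.
  move=> Cx; rewrite /crow_sum (bigD1 x) //= (cardD1 x) Cx add1n addSn ltnS.
  by rewrite addnCA leq_addr.
case/orP=> /row_bound /leq_trans -> //; first by rewrite leq_add2l leq_addr.
by rewrite eqAB leq_add2l leq_addl.
Qed.

(* Main.v *)
(* By the Jacobi triple product the generating function is the constant term
   in z of c^16 theta(z;q)^16, where c = 1/(q;q)_oo and theta(z;q) is the sum
   of z^m q^(m(m+1)/2). Repeatedly splitting squares of theta series by the
   parity of m - n writes the constant term of theta^16 as a polynomial in
   p = phi(q^8), r = q^2 psi(q^8) and y = q phi(q^4) psi(q^4), where phi(x)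
   sums x^(m^2) over m in Z, psi(x) sums x^(k(k+1)) over k >= 0, and
   y^2 = p r (p^2 + 4 r^2). Moreover c^16 phi(-q^4)^40 is
   phi(q)^8 phi(q^2)^20 c(q^4)^4, and phi(-q^4)^1024 = 1 modulo 2048. The
   resulting polynomial in p, r, y is, modulo 2048, a polynomial in p and r
   (even exponents of q), plus 256 p^41 y (exponents 1 mod 4), plus
   1024 p^40 r y; the last term is the only one with exponents 3 mod 4, and
   modulo 2048 its exponents are all 3 mod 8. Power series are truncated at
   q^(n+1), and sums over Z range over a finite support because q is
   nilpotent. *)
Require Import Defs.
From HB Require Import structures.
From mathcomp Require Import all_boot all_order all_algebra.
From mathcomp Require Import all_classical.
From mathcomp Require Import zify ring.

Set Implicit Arguments.
Unset Strict Implicit.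
Unset Printing Implicit Defensive.

Import GRing.Theory.
Local Open Scope ring_scope.

(** * Sums of finite support over infinite index types *)

(** Theta series are summed over all of Z without choosing bounds. The value is 0 when the support
    is infinite, so most rules assume [finsupp_in]. *)
Definition gsum (S : comNzRingType) (I : choiceType) (F : I -> S) : S :=
  \sum_(i \in [set: I]%classic) F i.

Definition finsupp_in (S : comNzRingType) (I : choiceType) (F : I -> S) :=
  exists r : seq I, forall i, F i != 0 -> i \in r.

Section FiniteSupportSums.
Variable S : comNzRingType.

Lemma gsumE (I : choiceType) (F : I -> S) (r : seq I) :
  uniq r -> (forall i, F i != 0 -> i \in r) -> gsum F = \sum_(i <- r) F i.
Proof.
move=> ur hr; rewrite /gsum (fsbigE r) //.
  by apply: eq_bigl => i; rewrite in_setT.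
by move=> i _ nir; apply/eqP; apply: contraNT nir; exact: hr.
Qed.

Lemma finsupp_uniq (I : choiceType) (F : I -> S) : finsupp_in F ->
  exists2 r : seq I, uniq r & forall i, F i != 0 -> i \in r.
Proof.
by case=> r hr; exists (undup r) => [|i /hr]; rewrite ?undup_uniq ?mem_undup.
Qed.

Lemma eq_gsum (I : choiceType) (F G : I -> S) : F =1 G -> gsum F = gsum G.
Proof. by move=> FG; congr gsum; apply: funext. Qed.

Lemma reindex_gsum (I J : choiceType) (h : I -> J) (F : J -> S) :
  bijective h -> gsum F = gsum (F \o h).
Proof. exact: reindex_fsbigT. Qed.

Lemma gsumMl (I : choiceType) (a : S) (F : I -> S) : finsupp_in F ->
  gsum (fun i => a * F i) = a * gsum F.
Proof.
case/finsupp_uniq=> r ur hr; rewrite (gsumE ur hr) (gsumE ur) ?mulr_sumr //.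
by move=> i aF; apply: hr; apply: contraNneq aF => ->; rewrite mulr0.
Qed.

Lemma finsupp_scale (I : choiceType) (a : S) (F : I -> S) :
  finsupp_in F -> finsupp_in (fun i => a * F i).
Proof.
case=> r hr; exists r => i aF; apply: hr.
by apply: contraNneq aF => ->; rewrite mulr0.
Qed.

Lemma gsumM (I J : choiceType) (F : I -> S) (G : J -> S) :
  finsupp_in F -> finsupp_in G ->
  gsum F * gsum G = gsum (fun p : I * J => F p.1 * G p.2).
Proof.
case/finsupp_uniq=> r ur hr /finsupp_uniq[t ut ht].
rewrite (gsumE ur hr) (gsumE ut ht) (@gsumE _ _ [seq (i, j) | i <- r, j <- t]).
- by rewrite big_allpairs big_distrl; apply: eq_bigr => i _; rewrite big_distrr.
- by apply: allpairs_uniq => // -[? ?] [? ?] _ _ [-> ->].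
case=> i j /= FG; apply: allpairs_f; [apply: hr|apply: ht].
  by apply: contraNneq FG => ->; rewrite mul0r.
by apply: contraNneq FG => ->; rewrite mulr0.
Qed.

Lemma finsuppM (I J : choiceType) (F : I -> S) (G : J -> S) :
  finsupp_in F -> finsupp_in G -> finsupp_in (fun p : I * J => F p.1 * G p.2).
Proof.
case=> r hr [t ht]; exists [seq (i, j) | i <- r, j <- t].
case=> i j /= FG; apply: allpairs_f; [apply: hr|apply: ht].
  by apply: contraNneq FG => ->; rewrite mul0r.
by apply: contraNneq FG => ->; rewrite mulr0.
Qed.

(** [K] is the disjoint union of the images of [h] and [k]. *)
Lemma gsum_split (I J K : choiceType) (h : I -> K) (k : J -> K) (F : K -> S) :
  injective h -> injective k -> (forall i j, h i != k j) ->
  (forall x, (exists i, x = h i) \/ (exists j, x = k j)) -> finsupp_in F ->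
  gsum F = gsum (F \o h) + gsum (F \o k).
Proof.
move=> ih ik hk sur /finsupp_uniq[r ur hr].
(* Partial inverses of [h] and [k], obtained by choice, pull the support list [r] back to [I] and
   [J]. *)
pose hi x := if pselect (exists i, x = h i) is left e then Some (projT1 (cid e)) else None.
pose ki x := if pselect (exists j, x = k j) is left e then Some (projT1 (cid e)) else None.
have hiK : ocancel hi h.
  by move=> x; rewrite /hi; case: pselect => //= e; case: cid.
have kiK : ocancel ki k.
  by move=> x; rewrite /ki; case: pselect => //= e; case: cid.
have hiE i : hi (h i) = Some i.
  rewrite /hi; case: pselect => [e|[]]; last by exists i.
  by case: cid => /= j /ih ->.
have kiE i : ki (k i) = Some i.
  rewrite /ki; case: pselect => [e|[]]; last by exists i.
  by case: cid => /= j /ik ->.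
have mhi i : F (h i) != 0 -> i \in pmap hi r.
  by move=> /hr hir; rewrite mem_pmap -hiE map_f.
have mki i : F (k i) != 0 -> i \in pmap ki r.
  by move=> /hr hir; rewrite mem_pmap -kiE map_f.
rewrite (gsumE _ mhi) ?(pmap_uniq hiK) // (gsumE _ mki) ?(pmap_uniq kiK) //=.
rewrite -(big_map h xpredT F) -(big_map k xpredT F) -big_cat; apply: gsumE.
  rewrite cat_uniq !map_inj_uniq // !(pmap_uniq hiK, pmap_uniq kiK) // andbT /=.
  by apply/hasPn => x /mapP[j _ ->]; apply/mapP => -[i _ /esym/eqP]; apply/negP.
move=> x Fx; rewrite mem_cat; case: (sur x) Fx => [[i ->] /mhi Fx|[i ->] /mki Fx].
  by rewrite map_f.
by rewrite (map_f k) ?orbT.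
Qed.

Lemma gsum_parity (F : int -> S) : finsupp_in F ->
  gsum F = gsum (fun m => F (2 * m)) + gsum (fun m => F (2 * m + 1)).
Proof.
apply: gsum_split => [m n|m n|m n|x]; try lia.
have [e|e] := boolP (2 %| `|x|)%N; [left|right].
  by exists (divz x 2); lia.
by exists (divz x 2); lia.
Qed.

(** Pairs of integers of equal parity are (s + e, s - e), the others (s + c + e, s + c - 1 - e). The
    free shift [c] allows the exponents of the odd part to be centred. All squaring formulas for
    theta series below come from this. *)
Lemma gsumM_parity (c : int) (F G A B C D : int -> S) :
  finsupp_in F -> finsupp_in G -> finsupp_in A -> finsupp_in B ->
  finsupp_in C -> finsupp_in D ->
  (forall s e, F (s + e) * G (s - e) = A s * B e) ->
  (forall s e, F (s + c + e) * G (s + c - 1 - e) = C s * D e) ->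
  gsum F * gsum G = gsum A * gsum B + gsum C * gsum D.
Proof.
move=> fF fG fA fB fC fD AB CD; rewrite !gsumM //.
pose h (p : int * int) := (p.1 + p.2, p.1 - p.2).
pose k (p : int * int) := (p.1 + c + p.2, p.1 + c - 1 - p.2).
rewrite (@gsum_split _ _ _ h k).
- by congr (_ + _); apply: eq_gsum => -[s e] /=.
- by move=> [s e] [s' e'] [? ?]; congr pair; lia.
- by move=> [s e] [s' e'] [? ?]; congr pair; lia.
- by move=> [s e] [s' e']; apply/eqP => -[]; lia.
- case=> m n; have [e|e] := boolP (2 %| `|m - n|)%N; [left|right].
    by exists (divz (m + n) 2, divz (m - n) 2); congr pair => /=; lia.
  by exists (divz (m + n + 1) 2 - c, divz (m - n) 2); congr pair => /=; lia.
- exact: finsuppM.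
Qed.

(** A nonzero term needs [e m < N], which bounds the absolute value of [m] by [N + b]. *)
Lemma finsupp_exp (x : S) (N b : nat) (e : int -> nat) (G : int -> S) :
  x ^+ N = 0 -> (forall m, `|m| <= e m + b)%N ->
  finsupp_in (fun m => x ^+ e m * G m).
Proof.
move=> x0 he; exists [seq (i%:Z - (N + b)%:Z) | i <- iota 0 (2 * (N + b)).+1].
move=> m Fm; have lt : (e m < N)%N.
  rewrite ltnNge; apply: contraNN Fm => /subnK <-.
  by rewrite exprD x0 mulr0 mul0r.
apply/mapP; exists (absz (m + (N + b)%:Z)); last by have := he m; move: lt; clear; lia.
by rewrite mem_iota; have := he m; move: lt; clear; lia.
Qed.

End FiniteSupportSums.

(** * Quadratic exponents *)

(** The forms m^2, m(m+1) and m(m+1)/2 are non-negative on Z, so [absz] loses nothing and yields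
    natural exponents for [^+]. *)
Definition sqz (m : int) : nat := absz (m * m).

Definition prz (m : int) : nat := absz (m * (m + 1)).

Definition tri (m : int) : nat := (prz m)./2.

Lemma sqzE m : (sqz m)%:Z = m * m.
Proof. rewrite /sqz; nia. Qed.

Lemma sqzN m : sqz (- m) = sqz m.
Proof. by rewrite /sqz mulrNN. Qed.

Lemma sqz_nat (n : nat) : sqz n = (n ^ 2)%N.
Proof. by rewrite /sqz abszM mulnn. Qed.

Lemma przE m : (prz m)%:Z = m * (m + 1).
Proof. rewrite /prz; nia. Qed.

Lemma prz_refl m : prz (-1 - m) = prz m.
Proof. have := (przE m, przE (-1 - m)); case; lia. Qed.

Lemma triE m : 2 * (tri m)%:Z = m * (m + 1).
Proof.
have even_prz : (2 %| prz m)%N.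
  rewrite /prz abszM Euclid_dvdM //; lia.
rewrite -przE /tri; lia.
Qed.

Lemma sqz_ge m : (`|m| <= sqz m + 1)%N.
Proof. have := sqzE m; nia. Qed.

Lemma prz_ge m : (`|m| <= prz m + 1)%N.
Proof. have := przE m; nia. Qed.

Lemma tri_ge m : (`|m| <= tri m + 1)%N.
Proof. have := triE m; nia. Qed.

(** * Theta series at a nilpotent argument *)

Section ThetaSeries.
Variable S : comNzRingType.
Implicit Types (x : S) (h : int -> S).

(** The weight [h m] stands for z^m. [chi], with even powers of z only, is what the odd part of the
    square of [theta] produces. *)
Definition theta h x := gsum (fun m => x ^+ tri m * h m).
Definition chi h x := gsum (fun m => x ^+ sqz m * h (2 * m)).
Definition phi x := gsum (fun m => x ^+ sqz m).
Definition psi2 x := gsum (fun m => x ^+ prz m).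
(* The sum of [x ^+ (k * (k + 1))] over [k : nat], as [k] is [2 m] or
   [- 2 m - 1]. *)
Definition psi x := gsum (fun m => x ^+ prz (2 * m)).

Lemma finsupp_exp1 x N b (e : int -> nat) :
  x ^+ N = 0 -> (forall m, `|m| <= e m + b)%N -> finsupp_in (fun m => x ^+ e m).
Proof.
move=> x0 he; have [r hr] := finsupp_exp (fun=> 1) x0 he.
by exists r => m xm; apply: hr; rewrite mulr1.
Qed.

Lemma expr_nil x N k : (0 < k)%N -> x ^+ N = 0 -> (x ^+ k) ^+ N = 0.
Proof. by move=> k0 x0; rewrite exprAC x0 expr0n gtn_eqF. Qed.

(** With t(m) = m(m+1)/2, the even part uses t(s+e) + t(s-e) = 2 t(s) + e^2 at z^(2s), the odd part
    t(s+e) + t(s-1-e) = s^2 + e(e+1) at z^(2s-1). *)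
Lemma theta_sqr h x N : x ^+ N = 0 -> (forall m n, h (m + n) = h m * h n) ->
  theta h x ^+ 2 =
    phi x * theta (fun m => h (2 * m)) (x ^+ 2) + psi2 x * (h (-1) * chi h x).
Proof.
move=> x0 hD; have x20 := @expr_nil x N 2 isT x0.
rewrite expr2 /chi -gsumMl; last exact: finsupp_exp x0 sqz_ge.
rewrite [phi x * _]mulrC [psi2 x * _]mulrC.
apply: (@gsumM_parity _ 0).
- exact: finsupp_exp x0 tri_ge.
- exact: finsupp_exp x0 tri_ge.
- exact: finsupp_exp x20 tri_ge.
- exact: finsupp_exp1 x0 sqz_ge.
- by apply: finsupp_scale; exact: finsupp_exp x0 sqz_ge.
- exact: finsupp_exp1 x0 prz_ge.
- move=> s e; rewrite mulrACA -exprD -hD -exprM mulrAC -exprD.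
  congr (_ ^+ _ * h _); last lia.
  have := (triE (s + e), triE (s - e), triE s, sqzE e); case=> [[[]]]; lia.
- move=> s e; rewrite mulrACA -exprD -hD [h (-1) * _]mulrCA -hD mulrAC -exprD.
  congr (_ ^+ _ * h _); last lia.
  have := (triE (s + 0 + e), triE (s + 0 - 1 - e), sqzE s, przE e); case=> [[[]]]; lia.
Qed.

(** The shift 1 makes the odd part (s+1+e)^2 + (s-e)^2 = 4 t(s) + 2e(e+1) + 1 with t(s) = s(s+1)/2,
    so [theta] reappears. *)
Lemma chi_sqr h x N : x ^+ N = 0 -> (forall m n, h (m + n) = h m * h n) ->
  chi h x ^+ 2 = phi (x ^+ 2) * chi (fun m => h (2 * m)) (x ^+ 2) +
    x * psi2 (x ^+ 2) * (h 2 * theta (fun m => h (4 * m)) (x ^+ 4)).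
Proof.
move=> x0 hD; have x20 := @expr_nil x N 2 isT x0.
have x40 := @expr_nil x N 4 isT x0.
rewrite expr2 /theta -gsumMl; last exact: finsupp_exp x40 tri_ge.
rewrite [phi _ * _]mulrC -[x * psi2 _]gsumMl; last exact: finsupp_exp1 x20 prz_ge.
rewrite [X in _ + X]mulrC.
apply: (@gsumM_parity _ 1).
- exact: finsupp_exp x0 sqz_ge.
- exact: finsupp_exp x0 sqz_ge.
- exact: finsupp_exp x20 sqz_ge.
- exact: finsupp_exp1 x20 sqz_ge.
- by apply: finsupp_scale; exact: finsupp_exp x40 tri_ge.
- by apply: finsupp_scale; exact: finsupp_exp1 x20 prz_ge.
- move=> s e; rewrite mulrACA -exprD -hD -!exprM mulrAC -exprD.
  congr (_ ^+ _ * h _); last lia.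
  have := (sqzE (s + e), sqzE (s - e), sqzE s, sqzE e); case=> [[[]]]; lia.
- move=> s e; rewrite mulrACA -exprD -hD [h 2 * _]mulrCA -hD -!exprM.
  rewrite mulrAC -exprS -exprD.
  congr (_ ^+ _ * h _); last lia.
  have := (sqzE (s + 1 + e), sqzE (s + 1 - 1 - e), triE s, przE e); case=> [[[]]]; lia.
Qed.

Lemma psi2E x N : x ^+ N = 0 -> psi2 x = 2 * psi x.
Proof.
move=> x0; rewrite /psi2 gsum_parity; last exact: finsupp_exp1 x0 prz_ge.
rewrite [X in _ + X](@reindex_gsum _ int int (fun k => -1 - k)); last first.
  by exists (fun k => -1 - k) => k; lia.
rewrite [2 * psi x]mulr_natl [psi x *+ 2]mulr2n; congr (_ + _); apply: eq_gsum => k.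
rewrite /comp; congr (x ^+ _).
by rewrite -prz_refl; congr prz; ring.
Qed.

Lemma phi_split x N : x ^+ N = 0 -> phi x = phi (x ^+ 4) + x * psi2 (x ^+ 4).
Proof.
move=> x0; have x40 := @expr_nil x N 4 isT x0.
rewrite /phi gsum_parity; last exact: finsupp_exp1 x0 sqz_ge.
rewrite -gsumMl; last exact: finsupp_exp1 x40 prz_ge.
congr (_ + _); apply: eq_gsum => k; rewrite -exprM -?exprS; congr (x ^+ _).
  by have := (sqzE (2 * k), sqzE k); case; lia.
by have := (sqzE (2 * k + 1), przE k); case; lia.
Qed.

Lemma phi_sqr x N : x ^+ N = 0 ->
  phi x ^+ 2 = phi (x ^+ 2) ^+ 2 + x * psi2 (x ^+ 2) ^+ 2.
Proof.
move=> x0; have x20 := @expr_nil x N 2 isT x0.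
rewrite [phi x ^+ 2]expr2 [phi (x ^+ 2) ^+ 2]expr2 [psi2 _ ^+ 2]expr2 mulrA.
rewrite -[x * psi2 _]gsumMl; last exact: finsupp_exp1 x20 prz_ge.
apply: (@gsumM_parity _ 1).
- exact: finsupp_exp1 x0 sqz_ge.
- exact: finsupp_exp1 x0 sqz_ge.
- exact: finsupp_exp1 x20 sqz_ge.
- exact: finsupp_exp1 x20 sqz_ge.
- by apply: finsupp_scale; exact: finsupp_exp1 x20 prz_ge.
- exact: finsupp_exp1 x20 prz_ge.
- move=> s e; rewrite -!exprM -!exprD; congr (x ^+ _).
  have := (sqzE (s + e), sqzE (s - e), sqzE s, sqzE e); case=> [[[]]]; lia.
- move=> s e; rewrite -!exprM -exprS -!exprD; congr (x ^+ _).
  have := (sqzE (s + 1 + e), sqzE (s + 1 - 1 - e), przE s, przE e); case=> [[[]]]; lia.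
Qed.

Lemma prz2_ge m : (`|m| <= prz (2 * m) + 1)%N.
Proof. have := przE (2 * m); nia. Qed.

(** Index pairs of equal parity produce the even-indexed terms of [phi (x ^+ 2)], the others its
    odd-indexed terms. The cofactor is [psi (x ^+ 2)] both times, up to the reflection m -> -m. *)
Lemma psi_sqr x N : x ^+ N = 0 -> psi x ^+ 2 = phi (x ^+ 2) * psi (x ^+ 2).
Proof.
move=> x0; have x20 := @expr_nil x N 2 isT x0.
have fe : finsupp_in (fun m => (x ^+ 2) ^+ sqz (2 * m)).
  by apply: (finsupp_exp1 (b := 1) x20) => m; have := sqzE (2 * m); nia.
have odd_pair (s e : int) : (prz (2 * (s + 0 + e)%R)%R + prz (2 * (s + 0 - 1 - e)%R)%R =
    2 * prz (2 * s - 1)%R + 2 * sqz (2 * e + 1)%R)%N.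
  have := (przE (2 * (s + 0 + e)), przE (2 * (s + 0 - 1 - e)),
           przE (2 * s - 1), sqzE (2 * e + 1)).
  case=> [[[]]] e1 e2 e3 e4; rewrite !mul2n -!addnn.
  by apply/eqP; rewrite -eqz_nat !PoszD e1 e2 e3 e4; apply/eqP; ring.
have przN k : prz (2 * - k) = prz (2 * k - 1).
  by rewrite -prz_refl; congr prz; ring.
have fo : finsupp_in (fun m => (x ^+ 2) ^+ sqz (2 * m + 1)).
  by apply: (finsupp_exp1 (b := 1) x20) => m; have := sqzE (2 * m + 1); nia.
rewrite [psi x ^+ 2]expr2 {1}/phi gsum_parity; last exact: finsupp_exp1 x20 sqz_ge.
rewrite mulrDl [X in _ = X + _]mulrC [X in _ = _ + X]mulrC.
rewrite [X in _ + X * _](@reindex_gsum _ int int (-%R : int -> int)); last first.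
  by exists (-%R : int -> int) => k; exact: opprK.
apply: (@gsumM_parity _ 0) => //.
- exact: finsupp_exp1 x0 prz2_ge.
- exact: finsupp_exp1 x0 prz2_ge.
- exact: finsupp_exp1 x20 prz2_ge.
- apply: (finsupp_exp1 (b := 1) x20) => m; rewrite -abszN; exact: prz2_ge.
- move=> s e; rewrite /comp -!exprM -!exprD; congr (x ^+ _).
  have := (przE (2 * (s + e)), przE (2 * (s - e)), przE (2 * s), sqzE (2 * e)).
  case=> [[[]]]; lia.
- move=> s e; rewrite /comp przN -!exprM -!exprD; congr (x ^+ _).
  exact: odd_pair.
Qed.

End ThetaSeries.

(** * Gaussian binomial coefficients *)

Section GaussianBinomials.
Variable S : comNzRingType.
Implicit Types x v : S.

Definition qfac x n := \prod_(i < n) (1 - x ^+ i.+1).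

(** A Pascal rule replaces the quotient of q-factorials, as [S] has no division. Where [n - k] is
    truncated, [qbin x n k] is 0. *)
Fixpoint qbin x n k : S :=
  match n, k with
  | _, 0 => 1
  | 0, _.+1 => 0
  | n.+1, k.+1 => qbin x n k.+1 + x ^+ (n - k) * qbin x n k
  end.

Lemma qfacS x n : qfac x n.+1 = qfac x n * (1 - x ^+ n.+1).
Proof. by rewrite /qfac big_ord_recr. Qed.

Lemma qbin0 x n : qbin x n 0 = 1. Proof. by case: n. Qed.

Lemma qbinS x n k :
  qbin x n.+1 k.+1 = qbin x n k.+1 + x ^+ (n - k) * qbin x n k.
Proof. by []. Qed.

Lemma qbin_small x n k : (n < k)%N -> qbin x n k = 0.
Proof.
by elim: n k => [|n IHn] [|k] //= lt_nk; rewrite !IHn ?mulr0 ?addr0 //; lia.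
Qed.

Lemma qbinSr x n k :
  qbin x n.+1 k.+1 = qbin x n k + x ^+ k.+1 * qbin x n k.+1.
Proof.
elim: n k => [|n IHn] k.
  by case: k => [|k] /=; rewrite ?mulr0 ?mulr1 ?addr0 ?add0r.
rewrite qbinS {1}IHn [in RHS]qbinS; case: k => [|k].
  by rewrite !qbin0 !subn0 !exprS; ring.
rewrite {1}IHn qbinS subSS; have [lt_nk|lt_kn] := ltnP n k.+1.
  by rewrite (@qbin_small x n k.+1) // (@qbin_small x n k.+2) ?(leqW lt_nk) //; ring.
have -> : (n - k = (n - k.+1).+1)%N by lia.
by rewrite !exprS; ring.
Qed.

Lemma qbinM_qfac x m k : qbin x (m + k) k * qfac x k * qfac x m = qfac x (m + k).
Proof.
elim: k m => [|k IHk] m; first by rewrite addn0 qbin0 /qfac big_ord0 !mul1r.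
elim: m => [|m IHm].
  rewrite add0n qbinS qbin_small // subnn expr0 add0r mul1r.
  have := IHk 0; rewrite add0n => e; rewrite !qfacS -{2}e; ring.
rewrite addSn qbinS [qfac x (m + k.+1).+1]qfacS.
have IHk' := IHk m.+1; rewrite addSnnS in IHk'.
have -> : (m + k.+1 - k = m.+1)%N by lia.
(* 1 - x^(m+k+2) = (1 - x^(m+1)) + x^(m+1) (1 - x^(k+1)). *)
transitivity ((qbin x (m + k.+1) k.+1 * qfac x k.+1 * qfac x m) * (1 - x ^+ m.+1)
  + x ^+ m.+1 * (1 - x ^+ k.+1) * (qbin x (m + k.+1) k * qfac x k * qfac x m.+1)).
  by rewrite !qfacS; ring.
rewrite IHm IHk' -addSn exprD; ring.
Qed.

(** The factors of index above [j] act on [v] as 1. *)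
Lemma qfac_stable x v j n : x ^+ j.+1 * v = 0 -> (j <= n)%N ->
  qfac x n * v = qfac x j * v.
Proof.
move=> xv /subnK <-; elim: (n - j)%N => [|i IHi] //.
rewrite addSn qfacS -mulrA mulrBl mul1r.
by rewrite -addnS exprD -mulrA xv mulr0 subr0.
Qed.

Lemma qfac_nil x N n : x ^+ N = 0 -> (N <= n)%N -> qfac x n = qfac x N.
Proof.
move=> x0 le_n; have := @qfac_stable x 1 N n; rewrite !mulr1 => -> //.
by rewrite exprS x0 mulr0.
Qed.

Lemma sum_qbin_recl x n (F : nat -> S) :
  \sum_(k < n.+2) qbin x n.+1 k * F k =
  F 0 + \sum_(k < n.+1) qbin x n.+1 k.+1 * F k.+1.
Proof. by rewrite big_ord_recl; congr (_ + _); exact: mul1r. Qed.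

Lemma sum_qbin_shift x n (F : nat -> S) :
  \sum_(k < n.+1) qbin x n k * F k =
  F 0 + \sum_(k < n.+1) qbin x n k.+1 * F k.+1.
Proof.
rewrite big_ord_recl [in RHS]big_ord_recr /= qbin0 mul1r.
by rewrite qbin_small // mul0r addr0.
Qed.

End GaussianBinomials.

(** * The Jacobi triple product *)

Section TripleProduct.
Variables (S : comNzRingType) (a b : S).
(** In the application a = zq and b = 1/z, hence x = q. The symmetric form in [a] and [b] needs no
    inverse of z. *)
Let x := a * b.

(* [x ^+ (m * (m - 1) / 2) * a ^+ m], written without negative exponents. *)
Definition jmon (m : int) := a ^+ tri m * b ^+ tri (- m).

Lemma triS m : (tri (m + 1))%:Z = (tri m)%:Z + m + 1.
Proof. have := (triE (m + 1), triE m); case; lia. Qed.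

Lemma jmonMa (n1 n2 k : nat) : (k <= n1 + n2)%N ->
  a * x ^+ n1 * jmon (k%:Z - n2%:Z) =
    x ^+ (n1 + n2 - k) * jmon (k.+1%:Z - n2%:Z).
Proof.
move=> le_k; set m : int := k%:Z - n2%:Z; set m' : int := _ - _.
have em : m = k%:Z - n2%:Z by [].
have e1 : m + 1 = m' by rewrite /m /m'; lia.
have := (triS m, triS (- m')); rewrite e1 (_ : - m' + 1 = - m); last by rewrite -e1; lia.
case=> t1 t2; rewrite /jmon /x !exprMn.
transitivity (a ^+ (1 + (n1 + tri m)) * b ^+ (n1 + tri (- m))).
  by rewrite !exprD expr1; ring.
transitivity (a ^+ (n1 + n2 - k + tri m') * b ^+ (n1 + n2 - k + tri (- m'))).
  by congr (_ ^+ _ * _ ^+ _); move: em e1 t1 t2 => *; lia.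
by rewrite !exprD; ring.
Qed.

Lemma jmonMb (n2 k : nat) :
  b * x ^+ n2 * jmon (k%:Z - n2%:Z) = x ^+ k * jmon (k%:Z - n2.+1%:Z).
Proof.
set m : int := k%:Z - n2%:Z; set m' : int := _ - _.
have em : m = k%:Z - n2%:Z by [].
have e1 : m' + 1 = m by rewrite /m /m'; lia.
have := (triS m', triS (- m)); rewrite e1 (_ : - m + 1 = - m'); last by rewrite -e1; lia.
case=> t1 t2; rewrite /jmon /x !exprMn.
transitivity (a ^+ (n2 + tri m) * b ^+ (1 + (n2 + tri (- m)))).
  by rewrite !exprD expr1; ring.
transitivity (a ^+ (k + tri m') * b ^+ (k + tri (- m'))).
  by congr (_ ^+ _ * _ ^+ _); move: em e1 t1 t2 => *; lia.
by rewrite !exprD; ring.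
Qed.

(** A two-sided form of the q-binomial theorem. Adding a factor in [a] uses one Pascal rule with
    [jmonMa], adding a factor in [b] the other with [jmonMb]. *)
Lemma finite_triple_product n1 n2 :
  (\prod_(j < n1) (1 + a * x ^+ j)) * (\prod_(j < n2) (1 + b * x ^+ j)) =
  \sum_(k < (n1 + n2).+1) qbin x (n1 + n2) k * jmon (k%:Z - n2%:Z).
Proof.
elim: n1 => [|n1 IHn1]; last first.
  rewrite big_ord_recr mulrAC IHn1 /= mulrDr mulr1 addSn.
  rewrite (sum_qbin_recl x _ (fun k => jmon (k%:Z - n2%:Z))).
  rewrite {1}(sum_qbin_shift x _ (fun k => jmon (k%:Z - n2%:Z))).
  rewrite -addrA; congr (_ + _); rewrite mulr_suml -big_split; apply: eq_bigr => -[k le_k] _.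
  rewrite qbinS mulrDl; congr (_ + _).
  transitivity (qbin x (n1 + n2) k * (a * x ^+ n1 * jmon (k%:Z - n2%:Z))) => /=.
    by ring.
  by rewrite jmonMa //; ring.
elim: n2 => [|n2 IHn2].
  rewrite !big_ord0 big_ord_recl big_ord0 qbin0 /jmon /=; ring.
rewrite mulrC big_ord_recr -mulrA mulrCA mulrC [_ * \prod_(j < 0) _]mulrC.
rewrite IHn2 addnS (sum_qbin_recl x _ (fun k => jmon (k%:Z - n2.+1%:Z))) mulrDr mulr1 addrC.
rewrite mulr_suml.
transitivity (\sum_(k < (0 + n2).+1) qbin x (0 + n2) k *
    (x ^+ k * jmon (k%:Z - n2.+1%:Z)) +
  \sum_(k < (0 + n2).+1) qbin x (0 + n2) k * jmon (k.+1%:Z - n2.+1%:Z)).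
  congr (_ + _); apply: eq_bigr => k _; last by congr (_ * jmon _); lia.
  by rewrite -mulrA [jmon _ * _]mulrC jmonMb.
rewrite (sum_qbin_shift x _ (fun k => x ^+ k * jmon (k%:Z - n2.+1%:Z))).
rewrite -addrA -big_split expr0 mul1r; congr (_ + _); apply: eq_bigr => k _.
by rewrite qbinSr mulrDl [RHS]addrC -mulrA [in RHS]mulrCA.
Qed.

(* For [N < |m|] the exponent is [0] by truncated subtraction, so [jmon m = 0]. *)
Lemma jmon_kill N m : x ^+ N = 0 -> x ^+ (N.+1 - `|m|) * jmon m = 0.
Proof.
move=> x0; have low k : (N <= k)%N -> x ^+ k = 0.
  by move/subnK <-; rewrite exprD x0 mulr0.
have [m0|m0] : 0 <= m \/ m <= 0 by lia.
  have -> : jmon m = x ^+ tri (- m) * a ^+ `|m|.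
    rewrite /jmon /x exprMn mulrAC -exprD; congr (_ ^+ _ * _).
    have := (triE m, triE (- m)); case; nia.
  rewrite mulrA -exprD low ?mul0r //; have := triE (- m); nia.
have -> : jmon m = x ^+ tri m * b ^+ `|m|.
  rewrite /jmon /x exprMn -mulrA -exprD; congr (_ * _ ^+ _).
  have := (triE m, triE (- m)); case; nia.
rewrite mulrA -exprD low ?mul0r //; have := triE m; nia.
Qed.

(** In the finite form with n1 = n2 = N, the larger of k and 2N - k is at least N, so its
    q-factorial equals [qfac x N]. The smaller one is N - |m| for m = k - N, and its q-factorial
    acts on [jmon m] as [qfac x N] does, by [jmon_kill]. So each Gaussian binomial acts on its
    monomial as [c]. *)
Lemma triple_product N c : x ^+ N = 0 -> c * qfac x N = 1 ->
  (\prod_(j < N) (1 + a * x ^+ j)) * (\prod_(j < N) (1 + b * x ^+ j)) =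
  c * gsum jmon.
Proof.
move=> x0 cq; rewrite finite_triple_product.
have qN n := @qfac_nil _ x N n x0.
rewrite (@gsumE _ _ _ [seq k%:Z - N%:Z | k <- iota 0 (N + N).+1]).
- rewrite big_map mulr_sumr -[iota _ _]/(index_iota 0 (N + N).+1) big_mkord.
  apply: eq_bigr => -[k le_k] _ /=; set m : int := k%:Z - N%:Z.
  pose v := jmon m; have kv := jmon_kill m x0.
  have qv : qfac x N * v = qfac x (N - `|m|) * v.
    by apply: qfac_stable; rewrite ?leq_subr // -subSn //; lia.
  (* The claim multiplied by [qfac x N ^+ 2], undone by [c * c]. *)
  suff: qbin x (N + N) k * qfac x N * (qfac x N * v) = qfac x N * v.
    move=> e; have := congr1 (fun t => c * c * t) e.
    have -> : c * c * (qbin x (N + N) k * qfac x N * (qfac x N * v)) =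
      (c * qfac x N) ^+ 2 * (qbin x (N + N) k * v) by ring.
    have -> : c * c * (qfac x N * v) = (c * qfac x N) * (c * v) by ring.
    by rewrite cq expr1n !mul1r.
  have := qbinM_qfac x (N + N - k) k; rewrite subnK; last lia.
  rewrite (qN (N + N)%N) ?leq_addr // => qq.
  rewrite {1}qv -[in RHS]qq; have [le_kN|lt_Nk] := leqP k N.
    have -> : (N - `|m| = k)%N by rewrite /m; lia.
    by rewrite (qN (N + N - k)%N); [ring|lia].
  have -> : (N - `|m| = N + N - k)%N by rewrite /m; lia.
  by rewrite (qN k); [ring|lia].
- by rewrite map_inj_uniq ?iota_uniq // => i j; lia.
move=> m jm; have lt_m : (`|m| <= N)%N.
  rewrite leqNgt; apply: contraNN jm => lt_m; have := jmon_kill m x0.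
  have -> : (N.+1 - `|m| = 0)%N by lia.
  by rewrite mul1r => ->.
apply/mapP; exists (absz (m + N%:Z)); last lia.
by rewrite mem_iota; lia.
Qed.

End TripleProduct.

(** * Eta quotients and phi modulo powers of 2 *)

Section EtaQuotients.
Variable S : comNzRingType.
Implicit Types x : S.

(* The inverse of [qfac x N] when [x ^+ N = 0], by geometric series. *)
Definition qinv x N := \prod_(i < N) \sum_(j < N) (x ^+ i.+1) ^+ j.

Lemma qinvK x N : x ^+ N = 0 -> qinv x N * qfac x N = 1.
Proof.
move=> x0; rewrite /qinv /qfac -big_split big1 // => i _ /=.
have xi0 : (x ^+ i.+1) ^+ N = 0 by exact: expr_nil.
rewrite mulrC -opprB mulNr -subrX1 xi0; ring.
Qed.

Lemma qfac_odd_even x n :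
  qfac x (n + n) = (\prod_(j < n) (1 - x * (x ^+ 2) ^+ j)) * qfac (x ^+ 2) n.
Proof.
elim: n => [|n IHn]; first by rewrite /qfac !big_ord0 mulr1.
rewrite addSn addnS !qfacS IHn big_ord_recr /= -!exprM.
have -> : (2 * n.+1 = (n + n).+2)%N by lia.
have -> : (2 * n = n + n)%N by lia.
by rewrite !exprS; ring.
Qed.

(** Gauss's product for phi(-x). The triple product at a = b = -x expresses the square of [d], which
    is (x; x^2)_N, and splitting (x; x)_(2N) into odd and even factors expresses [d] itself. *)
Lemma qinv_phiN x N : x ^+ N = 0 ->
  qinv x N ^+ 2 * phi (- x) = qinv (x ^+ 2) N.
Proof.
move=> x0; have x20 := @expr_nil _ x N 2 isT x0.
pose d := \prod_(j < N) (1 - x * (x ^+ 2) ^+ j).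
have xx : - x * - x = x ^+ 2 by ring.
have dphi : d ^+ 2 = qinv (x ^+ 2) N * phi (- x).
  have -> : phi (- x) = gsum (jmon (- x) (- x)).
    apply: eq_gsum => m; rewrite /jmon -exprD; congr (_ ^+ _).
    have := (triE m, triE (- m), sqzE m); case=> [[]]; lia.
  rewrite -(@triple_product _ (- x) (- x) N) ?xx ?qinvK // expr2 /d.
  by congr (_ * _); apply: eq_bigr => j _; rewrite mulNr.
have qN : qfac x (N + N) = qfac x N by rewrite (qfac_nil x0) ?leq_addr.
have cd : qinv x N * d * qfac (x ^+ 2) N = 1.
  by rewrite -mulrA -qfac_odd_even qN qinvK.
have e2 := qinvK x20; have e1 := qinvK x0.
set c1 := qinv x N in cd e1 *; set c2 := qinv (x ^+ 2) N in dphi e2 *.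
set f2 := qfac (x ^+ 2) N in cd e2.
have cd' : c1 * d = c2.
  by rewrite -[LHS]mulr1 -e2 mulrCA cd mulr1.
have -> : c1 ^+ 2 * phi (- x) = c1 ^+ 2 * (c2 * phi (- x)) * f2.
  by rewrite -[LHS]mulr1 -e2; ring.
by rewrite -dphi -exprMn cd' expr2 -mulrA e2 mulr1.
Qed.

Lemma phiN_split x N : x ^+ N = 0 ->
  phi (- x) = phi (x ^+ 4) - x * psi2 (x ^+ 4).
Proof.
move=> x0; rewrite (@phi_split _ (- x) N); last by rewrite exprNn x0 mulr0.
have -> : (- x) ^+ 4 = x ^+ 4 by ring.
by rewrite mulNr.
Qed.

(** Both sides become polynomials in x, phi(x^8) and psi(x^8). *)
Lemma phi_phiN x N : x ^+ N = 0 -> phi x * phi (- x) = phi (- x ^+ 2) ^+ 2.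
Proof.
move=> x0; have x20 := @expr_nil _ x N 2 isT x0.
have x40 := @expr_nil _ x N 4 isT x0.
rewrite (phi_split x0) (phiN_split x0) (phiN_split x20) -!exprM.
have := phi_sqr x40; have := psi_sqr x40; rewrite -!exprM !(@psi2E _ _ N) //; last first.
  exact: (@expr_nil _ x N 8).
move=> e1 e2.
have -> : (phi (x ^+ 4) + x * (2 * psi (x ^+ 4))) *
    (phi (x ^+ 4) - x * (2 * psi (x ^+ 4))) =
  phi (x ^+ 4) ^+ 2 - 4 * x ^+ 2 * psi (x ^+ 4) ^+ 2 by ring.
by rewrite e1 e2; ring.
Qed.

Lemma qinv_dissect x N : x ^+ N = 0 ->
  qinv x N ^+ 2 * phi (- x ^+ 2) ^+ 2 = phi x * qinv (x ^+ 2) N.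
Proof.
move=> x0; rewrite -(phi_phiN x0) -(qinv_phiN x0); ring.
Qed.

Lemma qinv16 x N : x ^+ N = 0 ->
  qinv x N ^+ 16 * phi (- x ^+ 4) ^+ 40 =
  phi x ^+ 8 * phi (x ^+ 2) ^+ 20 * qinv (x ^+ 4) N ^+ 4.
Proof.
move=> x0; have x20 := @expr_nil _ x N 2 isT x0.
have e1 := qinv_dissect x0; have e2 := qinv_dissect x20.
have e3 := phi_phiN x20; rewrite -!exprM in e1 e2 e3.
set c1 := qinv x N in e1 *; set c2 := qinv (x ^+ 2) N in e1 e2 *.
set c4 := qinv _ N in e2 *; set f := phi x in e1 *; set a := phi (x ^+ 2) in e2 e3 *.
set am := phi (- x ^+ 2) in e1 e3; set b := phi _ in e2 e3 *.
(* Of the 40 factors, 32 become [(a * am) ^+ 16], whose [am ^+ 16] turns c1^16 into f^8 c2^8. The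
   other 8 turn c2^8 into a^4 c4^4. *)
have -> : b ^+ 40 = (b ^+ 2) ^+ 16 * b ^+ 8 by ring.
rewrite -e3.
transitivity ((c1 ^+ 2 * am ^+ 2) ^+ 8 * a ^+ 16 * b ^+ 8); first ring.
rewrite e1.
transitivity (f ^+ 8 * a ^+ 16 * (c2 ^+ 2 * b ^+ 2) ^+ 4); first ring.
by rewrite e2; ring.
Qed.

(** Each squaring of 1 + 2^(k+1) v gains one factor 2. *)
Lemma char_expr_iter (u : S) k :
  exists v, (1 + 2 * u) ^+ (2 ^ k) = 1 + 2 ^+ k.+1 * v.
Proof.
elim: k => [|k [v IHk]]; first by exists u; rewrite expr1 expn0 expr1.
exists (v + 2 ^+ k * v ^+ 2); rewrite expnSr exprM IHk !exprS; ring.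
Qed.

(** The terms at m and -m agree, and the term at 0 is 1. *)
Lemma phi_odd x N : x ^+ N = 0 -> exists u, phi x = 1 + 2 * u.
Proof.
move=> x0; exists (\sum_(i < N.+1) x ^+ (i.+1 ^ 2)).
pose g := \sum_(i < N.+1) x ^+ (i.+1 ^ 2).
pose r1 := [seq - i.+1%:Z | i <- index_iota 0 N.+1].
pose r2 := [seq i.+1%:Z | i <- index_iota 0 N.+1].
have s1 : \sum_(m <- r1) x ^+ sqz m = g.
  by rewrite big_map big_mkord; apply: eq_bigr => i _; rewrite ?sqzN sqz_nat.
have s2 : \sum_(m <- r2) x ^+ sqz m = g.
  by rewrite big_map big_mkord; apply: eq_bigr => i _; rewrite ?sqzN sqz_nat.
rewrite /phi (@gsumE _ _ _ (0 :: r1 ++ r2)).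
- rewrite big_cons big_cat.
  change (1 + (\sum_(m <- r1) x ^+ sqz m + \sum_(m <- r2) x ^+ sqz m) = 1 + 2 * g).
  by rewrite s1 s2; ring.
- rewrite cons_uniq mem_cat negb_or cat_uniq.
  apply/andP; split; [apply/andP; split|apply/and3P; split].
  + by apply/mapP => -[i _]; lia.
  + by apply/mapP => -[i _]; lia.
  + by rewrite map_inj_uniq ?iota_uniq // => i j; lia.
  + by apply/hasPn => m /mapP[i _ ->]; apply/mapP => -[j _]; lia.
  + by rewrite map_inj_uniq ?iota_uniq // => i j; lia.
move=> m xm; have lt_m : (sqz m < N)%N.
  rewrite ltnNge; apply: contraNN xm => /subnK <-.
  by rewrite exprD x0 mulr0.
have le_m := sqz_ge m; rewrite inE mem_cat.
have [m0|[m0|->]] : (0 < m) \/ (m < 0) \/ (m = 0) by clear; lia.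
- apply/orP; right; apply/orP; right; apply/mapP.
  by exists (absz m).-1; rewrite ?mem_index_iota; lia.
- apply/orP; right; apply/orP; left; apply/mapP.
  by exists (absz m).-1; rewrite ?mem_index_iota; lia.
- by rewrite eqxx.
Qed.

End EtaQuotients.

(** * Theta series under ring morphisms *)

Section RingMorphism.
Variables (R S : comNzRingType) (f : {rmorphism R -> S}).

Lemma rmorph_gsum (I : choiceType) (F : I -> R) : finsupp_in F ->
  f (gsum F) = gsum (fun i => f (F i)).
Proof.
case/finsupp_uniq=> r ur hr; rewrite (gsumE ur hr) (gsumE ur) ?rmorph_sum //.
by move=> i fF; apply: hr; apply: contraNneq fF => ->; rewrite rmorph0.
Qed.

Lemma rmorph_gsum_exp x N b (e : int -> nat) :
  x ^+ N = 0 -> (forall m, `|m| <= e m + b)%N ->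
  f (gsum (fun m => x ^+ e m)) = gsum (fun m => f x ^+ e m).
Proof.
move=> x0 he; rewrite rmorph_gsum; last exact: finsupp_exp1 x0 he.
by apply: eq_gsum => m; rewrite rmorphXn.
Qed.

Lemma rmorph_phi x N : x ^+ N = 0 -> f (phi x) = phi (f x).
Proof. move=> x0; exact: rmorph_gsum_exp x0 sqz_ge. Qed.

Lemma rmorph_psi2 x N : x ^+ N = 0 -> f (psi2 x) = psi2 (f x).
Proof. move=> x0; exact: rmorph_gsum_exp x0 prz_ge. Qed.

Lemma rmorph_qinv x N : f (qinv x N) = qinv (f x) N.
Proof.
rewrite rmorph_prod; apply: eq_bigr => i _; rewrite rmorph_sum.
by apply: eq_bigr => j _; rewrite !rmorphXn.
Qed.

End RingMorphism.

(** * Constant terms in z *)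

Section ConstantTerm.
(** An abstract model of Laurent polynomials in z: [f] embeds the coefficients, [h m] is z^m and
    [ct] is the constant term. The form of [ct_h] admits a model with z^W = 1. *)
Variables (R S : comNzRingType) (f : {rmorphism R -> S}) (ct : {additive S -> R}).
Variables (h : int -> S) (W : nat).
Hypothesis ctM : forall a s, ct (f a * s) = a * ct s.
Hypothesis hD : forall m n, h (m + n) = h m * h n.
Hypothesis h0 : h 0 = 1.
Hypothesis ct_h : forall m, ct (h m) = (W %| `|m|)%N%:R.

(** Combinations of powers z^m with m = i modulo d, a grading in z that tells which products have no
    constant term. *)
Inductive zspan (d : nat) (i : int) : S -> Prop :=
| Zspan0 : zspan d i 0
| ZspanD a m s : (d%:Z %| m - i)%Z -> zspan d i s -> zspan d i (f a * h m + s).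

Lemma zspan_add d i s t : zspan d i s -> zspan d i t -> zspan d i (s + t).
Proof.
elim=> [|a m s' di _ IHs] zt; first by rewrite add0r.
by rewrite -addrA; apply: ZspanD => //; apply: IHs.
Qed.

Lemma zspan_term d i a m : (d%:Z %| m - i)%Z -> zspan d i (f a * h m).
Proof. by move=> di; rewrite -[_ * _]addr0; apply: ZspanD => //; left. Qed.

Lemma zspan_scale d i a s : zspan d i s -> zspan d i (f a * s).
Proof.
elim=> [|b m t di _ IHs]; first by rewrite mulr0; left.
by rewrite mulrDr mulrA -rmorphM; apply: ZspanD.
Qed.

Lemma zspan_mul d i j k s t : (d%:Z %| i + j - k)%Z ->
  zspan d i s -> zspan d j t -> zspan d k (s * t).
Proof.
move=> dk; elim=> [|a m s' di _ IHs] zt; first by rewrite mul0r; left.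
rewrite mulrDl; apply: zspan_add; last exact: IHs.
rewrite -mulrA; apply: zspan_scale; elim: zt => [|b n t' dj _ IHt].
  by rewrite mulr0; left.
rewrite mulrDr mulrCA -hD; apply: ZspanD => //.
have -> : m + n - k = (m - i) + (n - j) + (i + j - k) by ring.
by apply: rpredD => //; apply: rpredD.
Qed.

Lemma zspan_gsum d i (F : int -> S) : finsupp_in F ->
  (forall m, zspan d i (F m)) -> zspan d i (gsum F).
Proof.
case/finsupp_uniq=> r ur hr zF; rewrite (gsumE ur hr).
elim: r {ur hr} => [|m r IHr]; first by rewrite big_nil; left.
by rewrite big_cons; apply: zspan_add.
Qed.

(** If [W], hence [d], divided an exponent m = i modulo d, then [d] would divide [i]. *)
Lemma ct_zspan d i s : (d %| W)%N -> ~~ (d%:Z %| i)%Z -> zspan d i s -> ct s = 0.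
Proof.
move=> dW di; elim=> [|a m s' dm _ IHs]; first exact: raddf0.
rewrite raddfD IHs addr0 ctM ct_h; case: (boolP (W %| `|m|)%N) => [Wm|_]; last exact: mulr0.
have dm' : (d%:Z %| m)%Z by rewrite dvdzE; apply: dvdn_trans Wm.
by case/negP: di; rewrite -[i](subKr m) rpredB.
Qed.

(* The squares of [thd d x] and [chd d x] are linear combinations of
   [thd d.*2 (x ^+ 2)] and [chd d.*2 (x ^+ 2)]. Their degrees in [z] are [0]
   and [d] modulo [d.*2], so the two do not mix in a constant term. *)
Definition thd d x := theta (fun m => h (d.*2%:Z * m)) (x ^+ 2).
Definition chd d x := h (- d%:Z) * chi (fun m => h (d%:Z * m)) x.

Lemma thd_sqr d x N : x ^+ N = 0 ->
  thd d x ^+ 2 = phi (x ^+ 2) * thd d.*2 (x ^+ 2) + psi2 (x ^+ 2) * chd d.*2 (x ^+ 2).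
Proof.
move=> x0; have x20 := @expr_nil _ x N 2 isT x0.
rewrite /thd (theta_sqr x20) ?mulrN1; last by move=> m n; rewrite mulrDr hD.
congr (_ * _ + _ * (h _ * _)).
by apply: eq_gsum => m; congr (_ * h _); lia.
Qed.

Lemma chd_sqr d x N : x ^+ N = 0 ->
  chd d x ^+ 2 = phi (x ^+ 2) * chd d.*2 (x ^+ 2) +
    x * psi2 (x ^+ 2) * thd d.*2 (x ^+ 2).
Proof.
move=> x0; have x20 := @expr_nil _ x N 2 isT x0.
rewrite /chd exprMn (chi_sqr x0); last by move=> m n; rewrite mulrDr hD.
rewrite mulrDr; congr (_ + _).
  rewrite mulrCA; congr (_ * (_ * _)); first by rewrite expr2 -hD; congr h; lia.
  by apply: eq_gsum => m; congr (_ * h _); lia.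
rewrite mulrCA; congr (_ * _); rewrite mulrA expr2 -!hD.
(* The two shifts z^(-d) cancel the factor z^(2d) from [chi_sqr]. *)
rewrite (_ : - d%:Z + - d%:Z + d%:Z * 2 = 0) ?h0 ?mul1r; last by lia.
by rewrite /thd -!exprM; apply: eq_gsum => m; congr (_ * h _); lia.
Qed.

Hypothesis W16 : (16 %| W)%N.

Lemma zspan_thd d x N : x ^+ N = 0 -> zspan d.*2 0 (thd d (f x)).
Proof.
move=> x0; apply: zspan_gsum => [|m].
  by apply: (finsupp_exp (N := N) _ _ tri_ge); rewrite exprAC -rmorphXn x0 rmorph0 expr0n.
rewrite -!rmorphXn; apply: zspan_term; rewrite subr0; exact: dvdz_mulr.
Qed.

Lemma zspan_chd d x N : x ^+ N = 0 -> zspan d.*2 d%:Z (chd d (f x)).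
Proof.
move=> x0; rewrite /chd /chi -gsumMl; last first.
  by apply: (finsupp_exp (N := N) _ _ sqz_ge); rewrite -rmorphXn x0 rmorph0.
apply: zspan_gsum => [|m].
  apply: finsupp_scale.
  by apply: (finsupp_exp (N := N) _ _ sqz_ge); rewrite -rmorphXn x0 rmorph0.
rewrite mulrCA -hD -rmorphXn; apply: zspan_term.
have -> : - d%:Z + d%:Z * (2 * m) - d%:Z = d.*2%:Z * (m - 1) by lia.
exact: dvdz_mulr.
Qed.

(** * The constant term of theta^16 *)

Section Theta16.
Variables (q : R) (N : nat).
Hypotheses (q0 : q ^+ N = 0) (W_big : (16 * N.+1 < W)%N).

Lemma exp0 k : (0 < k)%N -> (q ^+ k) ^+ N = 0.
Proof. by move=> k0; apply: expr_nil. Qed.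

(** A surviving term z^(16m) has |m| <= N, so 16|m| < W and only m = 0 contributes. *)
Lemma ct_thd8 : ct (thd 8 (f (q ^+ 8))) = 1.
Proof.
have q160 := exp0 (isT : (0 < 16)%N).
have F0 : finsupp_in (fun m => f (q ^+ 16) ^+ tri m * h (16 * m)).
  by apply: (finsupp_exp (N := N) _ _ tri_ge); rewrite -rmorphXn q160 rmorph0.
have -> : thd 8 (f (q ^+ 8)) = gsum (fun m => f (q ^+ 16) ^+ tri m * h (16 * m)).
  by rewrite /thd -rmorphXn -exprM.
case: (finsupp_uniq F0) => r ur hr; rewrite (gsumE ur hr) raddf_sum.
have e m : ct (f (q ^+ 16) ^+ tri m * h (16 * m)) = (m == 0)%:R.
  rewrite -rmorphXn ctM ct_h; have [->|m0] := eqVneq m 0.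
    by rewrite mulr0 dvdn0 mulr1.
  have [le_N|lt_N] := leqP N (tri m).
    by rewrite -(subnK le_N) exprD q160 mulr0 mul0r.
  rewrite gtnNdvd ?mulr0 //; first lia.
  have := tri_ge m; lia.
(* The term at 0 is nonzero, since its constant term is 1. *)
have r0 : 0 \in r.
  apply: hr; apply: contraNneq (oner_neq0 R) => F00.
  by apply/eqP; have := e 0; rewrite F00 raddf0 eqxx => ->.
rewrite (eq_bigr _ (fun m _ => e m)) (bigD1_seq 0) // eqxx big1 => [|m m0].
  exact: addr0.
by rewrite (negPf m0).
Qed.

Let phq k := phi (q ^+ k).
Let psq k := psi2 (q ^+ k).

Lemma f_phi k : (0 < k)%N -> phi (f q ^+ k) = f (phq k).
Proof. by move=> k0; rewrite (rmorph_phi f (exp0 k0)) rmorphXn. Qed.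

Lemma f_psi2 k : (0 < k)%N -> psi2 (f q ^+ k) = f (psq k).
Proof. by move=> k0; rewrite (rmorph_psi2 f (exp0 k0)) rmorphXn. Qed.

Lemma fq0 : f q ^+ N = 0.
Proof. by rewrite -rmorphXn q0 rmorph0. Qed.

Lemma fqk k : (0 < k)%N -> (f q ^+ k) ^+ N = 0.
Proof. by move=> k0; apply: expr_nil => //; exact: fq0. Qed.

(** [T * X] has degrees 4 modulo 8. After squaring, [chd 8] has degrees 8 modulo 16 and vanishes,
    while [thd 8] contributes 1. *)
Lemma ct_level3 a b c :
  let T := thd 4 (f q ^+ 4) in let X := chd 4 (f q ^+ 4) in
  ct (f a * T ^+ 2 + f b * (T * X) + f c * X ^+ 2) =
  a * phq 8 + c * (q ^+ 4 * psq 8).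
Proof.
move=> T X; have z1 : zspan 16 8 (chd 8 (f (q ^+ 8))) := zspan_chd 8 (@exp0 8 isT).
have zT : zspan 8 0 T by rewrite /T -rmorphXn; exact: (zspan_thd 4 (@exp0 4 isT)).
have zX : zspan 8 4 X by rewrite /X -rmorphXn; exact: (zspan_chd 4 (@exp0 4 isT)).
rewrite !raddfD !ctM (@ct_zspan 8 4 (T * X)) //; last first.
- by apply: (zspan_mul _ zT zX).
- by apply: dvdn_trans W16.
rewrite mulr0 addr0 /T /X (thd_sqr 4 (@fqk 4 isT)) (chd_sqr 4 (@fqk 4 isT)) -!exprM.
rewrite f_phi // f_psi2 // -!rmorphXn -rmorphM !raddfD !ctM ct_thd8.
by rewrite (ct_zspan W16 _ z1) // !mulr1 !mulr0 addr0 add0r.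
Qed.

(** Odd powers of [X] have degrees 2 modulo 4 and drop out. The rest is a quadratic form in the next
    level. *)
Lemma ct_level2 a b c d e :
  let T := thd 2 (f q ^+ 2) in let X := chd 2 (f q ^+ 2) in
  ct (f a * T ^+ 4 + f b * (T ^+ 3 * X) + f c * (T * X) ^+ 2 +
      f d * (T * X ^+ 3) + f e * X ^+ 4) =
  a * (phq 4 ^+ 2 * phq 8 + psq 4 ^+ 2 * (q ^+ 4 * psq 8)) +
  c * (phq 4 * psq 4 * (q ^+ 2 * phq 8 + q ^+ 4 * psq 8)) +
  e * (phq 4 ^+ 2 * (q ^+ 4 * psq 8) + q ^+ 4 * psq 4 ^+ 2 * phq 8).
Proof.
move=> T X.
have zT : zspan 4 0 T by rewrite /T -rmorphXn; exact: (zspan_thd 2 (@exp0 2 isT)).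
have zX : zspan 4 2 X by rewrite /X -rmorphXn; exact: (zspan_chd 2 (@exp0 2 isT)).
have W4 : (4 %| W)%N by apply: dvdn_trans W16.
have zT2 : zspan 4 0 (T ^+ 2) by rewrite expr2; apply: (zspan_mul _ zT zT).
have zX2 : zspan 4 0 (X ^+ 2) by rewrite expr2; apply: (zspan_mul _ zX zX).
have zTX : zspan 4 2 (T * X) by apply: (zspan_mul _ zT zX).
rewrite !raddfD !ctM (@ct_zspan 4 2 (T ^+ 3 * X)) //; last first.
  by rewrite exprSr -mulrA; apply: (zspan_mul _ zT2 zTX).
rewrite (@ct_zspan 4 2 (T * X ^+ 3)) //; last first.
  by rewrite exprS mulrA; apply: (zspan_mul _ zTX zX2).
rewrite !mulr0 !addr0; set T' := thd 4 (f q ^+ 4); set X' := chd 4 (f q ^+ 4).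
have eT : T ^+ 2 = f (phq 4) * T' + f (psq 4) * X'.
  by rewrite /T (thd_sqr 2 (@fqk 2 isT)) -!exprM f_phi // f_psi2.
have eX : X ^+ 2 = f (phq 4) * X' + f (q ^+ 2 * psq 4) * T'.
  by rewrite /X (chd_sqr 2 (@fqk 2 isT)) -!exprM f_phi // f_psi2 // rmorphM rmorphXn.
congr (_ * _ + _ * _ + _ * _).
- have -> : T ^+ 4 = f (phq 4 ^+ 2) * T' ^+ 2 + f (2 * phq 4 * psq 4) * (T' * X') +
      f (psq 4 ^+ 2) * X' ^+ 2.
    by rewrite (exprM T 2 2) eT; ring.
  exact: ct_level3.
- have -> : (T * X) ^+ 2 = f (q ^+ 2 * phq 4 * psq 4) * T' ^+ 2 +
      f (phq 4 ^+ 2 + q ^+ 2 * psq 4 ^+ 2) * (T' * X') +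
      f (phq 4 * psq 4) * X' ^+ 2.
    by rewrite exprMn eT eX; ring.
  by rewrite ct_level3; ring.
have -> : X ^+ 4 = f (q ^+ 4 * psq 4 ^+ 2) * T' ^+ 2 +
    f (2 * q ^+ 2 * phq 4 * psq 4) * (T' * X') + f (phq 4 ^+ 2) * X' ^+ 2.
  by rewrite (exprM X 2 2) eX; ring.
by rewrite ct_level3; ring.
Qed.

(** theta^4 = E + O with E of even and O of odd degree in z, so only E^4 + 6 E^2 O^2 + O^4 counts.
    It is a quartic form in [thd 2] and [chd 2], with coefficients built from [E0], [E1] and the
    [O0], [O1], [O2] of O^2. *)
Lemma ct_theta16 :
  let E0 := phq 1 ^+ 2 * phq 2 + psq 1 ^+ 2 * q * psq 2 in
  let E1 := phq 1 ^+ 2 * psq 2 + psq 1 ^+ 2 * phq 2 in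
  let k := 4 * phq 1 ^+ 2 * psq 1 ^+ 2 in
  let O0 := k * q * phq 2 * psq 2 in
  let O1 := k * (phq 2 ^+ 2 + q * psq 2 ^+ 2) in
  let O2 := k * phq 2 * psq 2 in
  ct (theta h (f q) ^+ 16) =
  (E0 ^+ 4 + 6 * E0 ^+ 2 * O0 + O0 ^+ 2) *
    (phq 4 ^+ 2 * phq 8 + psq 4 ^+ 2 * (q ^+ 4 * psq 8)) +
  (6 * E0 ^+ 2 * E1 ^+ 2 + 6 * (E0 ^+ 2 * O2 + 2 * E0 * E1 * O1 + E1 ^+ 2 * O0) +
     (O1 ^+ 2 + 2 * O0 * O2)) *
    (phq 4 * psq 4 * (q ^+ 2 * phq 8 + q ^+ 4 * psq 8)) +
  (E1 ^+ 4 + 6 * E1 ^+ 2 * O2 + O2 ^+ 2) *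
    (phq 4 ^+ 2 * (q ^+ 4 * psq 8) + q ^+ 4 * psq 4 ^+ 2 * phq 8).
Proof.
move=> E0 E1 k O0 O1 O2.
set T1 := thd 1 (f (q ^+ 1)); set X1 := chd 1 (f (q ^+ 1)).
have zT : zspan 2 0 T1 := zspan_thd 1 (@exp0 1 isT).
have zX : zspan 2 1 X1 := zspan_chd 1 (@exp0 1 isT).
have e1 : theta h (f q) ^+ 2 = f (phq 1) * T1 + f (psq 1) * X1.
  rewrite (theta_sqr fq0 hD) -f_phi // -f_psi2 // /T1 /X1 !expr1.
  by congr (_ * _ + _ * (_ * _)); apply: eq_gsum => m; congr (_ * h _); lia.
have W2 : (2 %| W)%N by apply: dvdn_trans W16.
pose E := f (phq 1 ^+ 2) * T1 ^+ 2 + f (psq 1 ^+ 2) * X1 ^+ 2.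
pose O := f (2 * phq 1 * psq 1) * (T1 * X1).
have zE : zspan 2 0 E.
  apply: zspan_add; apply: zspan_scale; rewrite expr2; first by apply: (zspan_mul _ zT zT).
  by apply: (zspan_mul _ zX zX).
have zO : zspan 2 1 O by apply: zspan_scale; apply: (zspan_mul _ zT zX).
have zEO : zspan 2 1 (E * O) by apply: (zspan_mul _ zE zO).
have zE2 : zspan 2 0 (E ^+ 2) by rewrite expr2; apply: (zspan_mul _ zE zE).
have zO2 : zspan 2 0 (O ^+ 2) by rewrite expr2; apply: (zspan_mul _ zO zO).
have zS : zspan 2 0 (E ^+ 2 + O ^+ 2) by apply: zspan_add.
have e16 : theta h (f q) ^+ 16 = (E ^+ 4 + 6 * E ^+ 2 * O ^+ 2 + O ^+ 4) +
    f 4 * (E * O * (E ^+ 2 + O ^+ 2)).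
  by rewrite (exprM _ 2 8) e1 /E /O; ring.
rewrite e16 raddfD ctM (@ct_zspan 2 1 (E * O * _)) //; last by apply: (zspan_mul _ zEO zS).
rewrite mulr0 addr0.
set T := thd 2 (f q ^+ 2); set X := chd 2 (f q ^+ 2).
have eT : T1 ^+ 2 = f (phq 2) * T + f (psq 2) * X.
  by rewrite /T1 expr1 (thd_sqr 1 fq0) f_phi // f_psi2.
have eX : X1 ^+ 2 = f (phq 2) * X + f (q * psq 2) * T.
  by rewrite /X1 expr1 (chd_sqr 1 fq0) f_phi // f_psi2 // rmorphM.
have eE : E = f E0 * T + f E1 * X by rewrite /E eT eX /E0 /E1; ring.
have eO : O ^+ 2 = f O0 * T ^+ 2 + f O1 * (T * X) + f O2 * X ^+ 2.
  rewrite /O exprMn exprMn eT eX /O0 /O1 /O2 /k; ring.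
(* [b] and [d] are the coefficients of T^3 X and T X^3, which [ct_level2] discards. *)
pose b := 4 * E0 ^+ 3 * E1 + 6 * (E0 ^+ 2 * O1 + 2 * E0 * E1 * O0) + 2 * O0 * O1.
pose d := 4 * E0 * E1 ^+ 3 + 6 * (E1 ^+ 2 * O1 + 2 * E0 * E1 * O2) + 2 * O1 * O2.
rewrite -(ct_level2 _ b _ d _) -/T -/X; congr (ct _).
rewrite (exprM O 2 2) eO eE /b /d.
move: E0 E1 O0 O1 O2 {eE eO b d} => E0 E1 O0 O1 O2; ring.
Qed.

End Theta16.
End ConstantTerm.

(* The terms without [y]; only the parity of their exponents of [q] matters. *)
Definition even_part (R : comNzRingType) (p r : R) : R :=
  p ^+ 43 + 9 * 2 ^+ 6 * p ^+ 42 * r - 196 * p ^+ 41 * r ^+ 2 - 2 ^+ 9 * p ^+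
  40 * r ^+ 3 - 31 * 2 ^+ 5 * p ^+ 39 * r ^+ 4 + 384 * p ^+ 37 * r ^+ 6 + 256
  * p ^+ 35 * r ^+ 8 + 2 ^+ 10 * p ^+ 33 * r ^+ 10.

(** * The polynomial congruence modulo 2048 *)

Section PolynomialCongruence.
Variables (R : comNzRingType) (p r y : R).
Hypotheses (h2048 : 2 ^+ 11 = 0 :> R) (hy : y ^+ 2 = p * r * (p ^+ 2 + 4 * r ^+ 2)).
(** [al] is phi(q^2) and [f2] is phi(q)^2. [e], [g], [O0], [O1], [O2] are the E0, E1, O0, O1, O2 of
    [ct_theta16], the one of index i being divided by (2 psi(q^2))^i. *)
Let al := p + 2 * r.
Let f2 := al ^+ 2 + 4 * y.
Let e := al * (f2 + 8 * y).
Let g := f2 + 2 * al ^+ 2.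
Let O0 := 32 * f2 * al ^+ 2 * y.
Let O1 := 8 * f2 * al * (al ^+ 2 + 4 * y).
Let O2 := 8 * f2 * al ^+ 2.

Lemma modulo (z x t : R) : x = t + 2 ^+ 11 * z -> x = t.
Proof. by rewrite h2048 mul0r addr0. Qed.

(* Each step exhibits the multiple of [2 ^+ 11] by which the two sides differ,
   which makes it an identity over the integers up to [hy]. *)
Lemma theta16_mod2048 :
  f2 ^+ 4 * al ^+ 20 *
  ((e ^+ 4 + 6 * e ^+ 2 * O0 + O0 ^+ 2) * (p * (p ^+ 2 + 12 * r ^+ 2)) +
   (6 * e ^+ 2 * g ^+ 2 + 6 * (e ^+ 2 * O2 + 2 * e * g * O1 + g ^+ 2 * O0) +
      (O1 ^+ 2 + 2 * O0 * O2)) * (8 * al * y ^+ 2) +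
   (g ^+ 4 + 6 * g ^+ 2 * O2 + O2 ^+ 2) *
     (32 * y ^+ 2 * r * (3 * p ^+ 2 + 4 * r ^+ 2))) =
    even_part p r + 2 ^+ 8 * p ^+ 41 * y + 2 ^+ 10 * p ^+ 40 * r * y.
Proof.
rewrite /even_part.
(* Powers are reduced modulo 2^11 and [hy] stage by stage, so that later stages start from forms at
   most linear in [y]. *)
have al5 : al ^+ 5 =
    p ^+ 5 + 10 * p ^+ 4 * r + 40 * p ^+ 3 * r ^+ 2 + 80 * p ^+ 2 * r ^+ 3 +
    80 * p * r ^+ 4 + 32 * r ^+ 5.
  rewrite /al.
  by ring: hy.
have al10 : al ^+ 10 =
    p ^+ 10 + 20 * p ^+ 9 * r + 180 * p ^+ 8 * r ^+ 2 + 15 * 2 ^+ 6 * p ^+ 7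
    * r ^+ 3 - 23 * 2 ^+ 5 * p ^+ 6 * r ^+ 4 - 128 * p ^+ 5 * r ^+ 5 - 7 * 2
    ^+ 7 * p ^+ 4 * r ^+ 6 + 2 ^+ 10 * p ^+ 3 * r ^+ 7 - 3 * 2 ^+ 8 * p ^+ 2
    * r ^+ 8 + 2 ^+ 10 * p * r ^+ 9 + 2 ^+ 10 * r ^+ 10.
  rewrite (exprM al 5 2) al5.
  apply: (@modulo (
    2 * p ^+ 6 * r ^+ 4 + 4 * p ^+ 5 * r ^+ 5 + 7 * p ^+ 4 * r ^+ 6 + 7 * p
    ^+ 3 * r ^+ 7 + 6 * p ^+ 2 * r ^+ 8 + 2 * p * r ^+ 9) _ _).
  by ring: hy.
have al20 : al ^+ 20 =
    p ^+ 20 + 40 * p ^+ 19 * r + 95 * 2 ^+ 3 * p ^+ 18 * r ^+ 2 + 29 * 2 ^+ 5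
    * p ^+ 17 * r ^+ 3 - 304 * p ^+ 16 * r ^+ 4 + 2 ^+ 9 * p ^+ 15 * r ^+ 5 +
    2 ^+ 9 * p ^+ 14 * r ^+ 6 + 2 ^+ 9 * p ^+ 12 * r ^+ 8.
  rewrite (exprM al 10 2) al10.
  apply: (@modulo (
    4 * p ^+ 17 * r ^+ 3 + 34 * p ^+ 16 * r ^+ 4 + 154 * p ^+ 15 * r ^+ 5 +
    317 * p ^+ 14 * r ^+ 6 - (2 ^+ 9 + 217) * p ^+ 13 * r ^+ 7 + 6 * p ^+ 12
    * r ^+ 8 - 291 * 2 ^+ 1 * p ^+ 11 * r ^+ 9 + ((2 ^+ 9 + 237)) * 2 ^+ 1 *
    p ^+ 10 * r ^+ 10 - 143 * 2 ^+ 3 * p ^+ 9 * r ^+ 11 + 489 * 2 ^+ 2 * p ^+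
    8 * r ^+ 12 - 9 * 2 ^+ 6 * p ^+ 7 * r ^+ 13 + 320 * p ^+ 6 * r ^+ 14 - 7
    * 2 ^+ 8 * p ^+ 5 * r ^+ 15 + 416 * p ^+ 4 * r ^+ 16 + 256 * p ^+ 3 * r
    ^+ 17 - 256 * p ^+ 2 * r ^+ 18 + 2 ^+ 10 * p * r ^+ 19 + 2 ^+ 9 * r ^+
    20) _ _).
  by ring: hy.
have f8 : f2 ^+ 4 =
    p ^+ 8 + 112 * p ^+ 7 * r - 57 * 2 ^+ 4 * p ^+ 6 * r ^+ 2 - 15 * 2 ^+ 6 *
    p ^+ 5 * r ^+ 3 - 29 * 2 ^+ 5 * p ^+ 4 * r ^+ 4 + 256 * p ^+ 3 * r ^+ 5 -
    256 * p ^+ 2 * r ^+ 6 + 2 ^+ 10 * p * r ^+ 7 + 256 * r ^+ 8 + 16 * p ^+ 6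
    * y + 448 * p ^+ 5 * r * y - 64 * p ^+ 4 * r ^+ 2 * y + 2 ^+ 9 * p ^+ 3 *
    r ^+ 3 * y - 256 * p ^+ 2 * r ^+ 4 * y + 2 ^+ 10 * p * r ^+ 5 * y + 2 ^+
    10 * r ^+ 6 * y.
  rewrite /f2 /al.
  apply: (@modulo (
    p ^+ 6 * r ^+ 2 + 2 * p ^+ 5 * r ^+ 3 + 5 * p ^+ 4 * r ^+ 4 + 6 * p ^+ 3
    * r ^+ 5 + 9 * p ^+ 2 * r ^+ 6 + 3 * p * r ^+ 7 + p ^+ 4 * r ^+ 2 * y + 2
    * p ^+ 3 * r ^+ 3 * y + 4 * p ^+ 2 * r ^+ 4 * y + 3 * p * r ^+ 5 * y) _
    _).
  by ring: hy.
have pref : f2 ^+ 4 * al ^+ 20 =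
    p ^+ 28 + 152 * p ^+ 27 * r + 232 * p ^+ 26 * r ^+ 2 - 17 * 2 ^+ 5 * p ^+
    25 * r ^+ 3 - 80 * p ^+ 24 * r ^+ 4 + 256 * p ^+ 23 * r ^+ 5 + 256 * p ^+
    22 * r ^+ 6 + 2 ^+ 10 * p ^+ 21 * r ^+ 7 + 256 * p ^+ 20 * r ^+ 8 + 16 *
    p ^+ 26 * y - 15 * 2 ^+ 6 * p ^+ 25 * r * y - 11 * 2 ^+ 6 * p ^+ 24 * r
    ^+ 2 * y + 2 ^+ 10 * p ^+ 23 * r ^+ 3 * y - 2 ^+ 9 * p ^+ 22 * r ^+ 4 *
    y.
  rewrite f8 al20.
  apply: (@modulo (
    2 * p ^+ 26 * r ^+ 2 + 24 * p ^+ 25 * r ^+ 3 - 307 * p ^+ 24 * r ^+ 4 -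
    201 * 2 ^+ 2 * p ^+ 23 * r ^+ 5 - (2 ^+ 9 + 99) * p ^+ 22 * r ^+ 6 - 388
    * p ^+ 21 * r ^+ 7 - 289 * p ^+ 20 * r ^+ 8 - 213 * p ^+ 19 * r ^+ 9 +
    201 * p ^+ 18 * r ^+ 10 - 276 * p ^+ 17 * r ^+ 11 - 78 * p ^+ 16 * r ^+
    12 + 384 * p ^+ 15 * r ^+ 13 + 256 * p ^+ 13 * r ^+ 15 + 64 * p ^+ 12 * r
    ^+ 16 + p ^+ 25 * r * y + 15 * p ^+ 24 * r ^+ 2 * y + 172 * p ^+ 23 * r
    ^+ 3 * y + 187 * p ^+ 22 * r ^+ 4 * y + 94 * p ^+ 21 * r ^+ 5 * y + 283 *
    p ^+ 20 * r ^+ 6 * y + 304 * p ^+ 19 * r ^+ 7 * y + 499 * 2 ^+ 1 * p ^+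
    18 * r ^+ 8 * y + 488 * p ^+ 17 * r ^+ 9 * y + 24 * p ^+ 16 * r ^+ 10 * y
    + 5 * 2 ^+ 7 * p ^+ 15 * r ^+ 11 * y + 192 * p ^+ 14 * r ^+ 12 * y + 256
    * p ^+ 13 * r ^+ 13 * y + 256 * p ^+ 12 * r ^+ 14 * y) _ _).
  by ring: hy.
have e2 : e ^+ 2 =
    p ^+ 6 + 156 * p ^+ 5 * r + 159 * 2 ^+ 2 * p ^+ 4 * r ^+ 2 - 23 * 2 ^+ 5
    * p ^+ 3 * r ^+ 3 + 496 * p ^+ 2 * r ^+ 4 + 448 * p * r ^+ 5 + 64 * r ^+
    6 + 24 * p ^+ 4 * y + 192 * p ^+ 3 * r * y + 9 * 2 ^+ 6 * p ^+ 2 * r ^+ 2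
    * y + 3 * 2 ^+ 8 * p * r ^+ 3 * y + 384 * r ^+ 4 * y.
  rewrite /e /g /f2 /al.
  apply: (@modulo (
    p ^+ 3 * r ^+ 3 + p ^+ 2 * r ^+ 4 + p * r ^+ 5) _ _).
  by ring: hy.
have e4 : e ^+ 4 =
    p ^+ 12 + 111 * 2 ^+ 3 * p ^+ 11 * r + 8 * p ^+ 10 * r ^+ 2 - 416 * p ^+
    9 * r ^+ 3 - 272 * p ^+ 8 * r ^+ 4 - 256 * p ^+ 7 * r ^+ 5 - 256 * p ^+ 6
    * r ^+ 6 + 2 ^+ 10 * p ^+ 5 * r ^+ 7 - 256 * p ^+ 4 * r ^+ 8 + 48 * p ^+
    10 * y - 320 * p ^+ 9 * r * y - 9 * 2 ^+ 6 * p ^+ 8 * r ^+ 2 * y + 2 ^+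
    10 * p ^+ 7 * r ^+ 3 * y - 2 ^+ 9 * p ^+ 6 * r ^+ 4 * y.
  rewrite (exprM e 2 2) e2.
  apply: (@modulo (
    17 * p ^+ 10 * r ^+ 2 + 129 * p ^+ 9 * r ^+ 3 + 230 * p ^+ 8 * r ^+ 4 +
    60 * p ^+ 7 * r ^+ 5 + (3 * 2 ^+ 9 + 113) * p ^+ 6 * r ^+ 6 + (3 * 2 ^+ 9
    + 159) * p ^+ 5 * r ^+ 7 + ((2 ^+ 10 + 47)) * 2 ^+ 1 * p ^+ 4 * r ^+ 8 +
    (2 ^+ 11 + 211) * p ^+ 3 * r ^+ 9 + (5 * 2 ^+ 8 + 1) * p ^+ 2 * r ^+ 10 +
    316 * p * r ^+ 11 + 2 * r ^+ 12 + 4 * p ^+ 9 * r * y + 45 * p ^+ 8 * r ^+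
    2 * y + 190 * p ^+ 7 * r ^+ 3 * y + 349 * p ^+ 6 * r ^+ 4 * y + 225 * p
    ^+ 5 * r ^+ 5 * y + 51 * p ^+ 4 * r ^+ 6 * y + 360 * p ^+ 3 * r ^+ 7 * y
    + 279 * 2 ^+ 1 * p ^+ 2 * r ^+ 8 * y + 216 * p * r ^+ 9 * y + 24 * r ^+
    10 * y) _ _).
  by ring: hy.
have g2 : g ^+ 2 =
    9 * p ^+ 4 + 88 * p ^+ 3 * r + 216 * p ^+ 2 * r ^+ 2 + 352 * p * r ^+ 3 +
    144 * r ^+ 4 + 24 * p ^+ 2 * y + 96 * p * r * y + 96 * r ^+ 2 * y.
  rewrite /e /g /f2 /al.
  by ring: hy.
have g4 : g ^+ 4 =
    81 * p ^+ 8 + 112 * p ^+ 7 * r - 144 * p ^+ 6 * r ^+ 2 - 15 * 2 ^+ 6 * p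
    ^+ 5 * r ^+ 3 + 19 * 2 ^+ 5 * p ^+ 4 * r ^+ 4 + 256 * p ^+ 3 * r ^+ 5 -
    256 * p ^+ 2 * r ^+ 6 + 2 ^+ 10 * p * r ^+ 7 + 256 * r ^+ 8 + 432 * p ^+
    6 * y - 192 * p ^+ 5 * r * y + 320 * p ^+ 4 * r ^+ 2 * y - 2 ^+ 9 * p ^+
    3 * r ^+ 3 * y - 3 * 2 ^+ 8 * p ^+ 2 * r ^+ 4 * y + 2 ^+ 10 * p * r ^+ 5
    * y + 2 ^+ 10 * r ^+ 6 * y.
  rewrite (exprM g 2 2) g2.
  apply: (@modulo (
    p ^+ 7 * r + 8 * p ^+ 6 * r ^+ 2 + 30 * p ^+ 5 * r ^+ 3 + 72 * p ^+ 4 * r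
    ^+ 4 + 118 * p ^+ 3 * r ^+ 5 + 127 * p ^+ 2 * r ^+ 6 + 67 * p * r ^+ 7 +
    10 * r ^+ 8 + 3 * p ^+ 5 * r * y + 14 * p ^+ 4 * r ^+ 2 * y + 37 * p ^+ 3
    * r ^+ 3 * y + 57 * p ^+ 2 * r ^+ 4 * y + 46 * p * r ^+ 5 * y + 13 * r ^+
    6 * y) _ _).
  by ring: hy.
(* [S0], [S2], [S4] reduce the coefficients of T^4, T^2 X^2 and X^4, without their powers of 2
   psi(q^2). *)
have S0 : e ^+ 4 + 6 * e ^+ 2 * O0 + O0 ^+ 2 =
    p ^+ 12 - 113 * 2 ^+ 3 * p ^+ 11 * r + 8 * p ^+ 10 * r ^+ 2 + 19 * 2 ^+ 5
    * p ^+ 9 * r ^+ 3 - 272 * p ^+ 8 * r ^+ 4 - 256 * p ^+ 7 * r ^+ 5 - 256 *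
    p ^+ 6 * r ^+ 6 + 2 ^+ 10 * p ^+ 5 * r ^+ 7 - 256 * p ^+ 4 * r ^+ 8 + 240
    * p ^+ 10 * y + 448 * p ^+ 9 * r * y - 13 * 2 ^+ 6 * p ^+ 8 * r ^+ 2 * y
    + 2 ^+ 10 * p ^+ 7 * r ^+ 3 * y - 2 ^+ 9 * p ^+ 6 * r ^+ 4 * y.
  rewrite e4 e2 /O0 /f2 /al.
  apply: (@modulo (
    4 * p ^+ 11 * r + 112 * p ^+ 10 * r ^+ 2 + 429 * 2 ^+ 1 * p ^+ 9 * r ^+ 3
    + 11 * 2 ^+ 8 * p ^+ 8 * r ^+ 4 + ((3 * 2 ^+ 9 + 217)) * 2 ^+ 2 * p ^+ 7
    * r ^+ 5 + 59 * 2 ^+ 8 * p ^+ 6 * r ^+ 6 + ((5 * 2 ^+ 8 + 89)) * 2 ^+ 4 *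
    p ^+ 5 * r ^+ 7 + 13 * 2 ^+ 11 * p ^+ 4 * r ^+ 8 + ((3 * 2 ^+ 8 + 181)) *
    2 ^+ 5 * p ^+ 3 * r ^+ 9 + 2 ^+ 14 * p ^+ 2 * r ^+ 10 + 25 * 2 ^+ 7 * p *
    r ^+ 11 + 28 * p ^+ 9 * r * y + 335 * p ^+ 8 * r ^+ 2 * y + ((3 * 2 ^+ 8
    + 29)) * 2 ^+ 1 * p ^+ 7 * r ^+ 3 * y + (2 ^+ 12 + 3) * p ^+ 6 * r ^+ 4 *
    y + ((3 * 2 ^+ 9 + 249)) * 2 ^+ 2 * p ^+ 5 * r ^+ 5 * y + ((5 * 2 ^+ 9 +
    195)) * 2 ^+ 2 * p ^+ 4 * r ^+ 6 * y + 461 * 2 ^+ 5 * p ^+ 3 * r ^+ 7 * y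
    + ((5 * 2 ^+ 8 + 247)) * 2 ^+ 3 * p ^+ 2 * r ^+ 8 * y + 131 * 2 ^+ 5 * p
    * r ^+ 9 * y + 96 * r ^+ 10 * y) _ _).
  by ring: hy.
have S2 : 6 * e ^+ 2 * g ^+ 2 + 6 * (e ^+ 2 * O2 + 2 * e * g * O1 + g ^+ 2 * O0) +
    (O1 ^+ 2 + 2 * O0 * O2) =
    454 * p ^+ 10 - 73 * 2 ^+ 3 * p ^+ 9 * r + 56 * p ^+ 8 * r ^+ 2 - 384 * p
    ^+ 7 * r ^+ 3 + 11 * 2 ^+ 6 * p ^+ 6 * r ^+ 4 - 3 * 2 ^+ 8 * p ^+ 5 * r
    ^+ 5 + 3 * 2 ^+ 8 * p ^+ 4 * r ^+ 6 - 2 ^+ 9 * p ^+ 2 * r ^+ 8 - 96 * p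
    ^+ 8 * y + 2 ^+ 10 * p ^+ 7 * r * y - 2 ^+ 9 * p ^+ 6 * r ^+ 2 * y + 2 ^+
    10 * p ^+ 4 * r ^+ 4 * y.
  rewrite e2 g2 /e /g /O0 /O1 /O2 /f2 /al.
  apply: (@modulo (
    46 * p ^+ 9 * r + 37 * 2 ^+ 4 * p ^+ 8 * r ^+ 2 + ((2 ^+ 9 + 233)) * 2 ^+
    2 * p ^+ 7 * r ^+ 3 + ((17 * 2 ^+ 8 + 147)) * 2 ^+ 1 * p ^+ 6 * r ^+ 4 +
    (77 * 2 ^+ 8 + 245) * p ^+ 5 * r ^+ 5 + (129 * 2 ^+ 8 + 17) * p ^+ 4 * r
    ^+ 6 + (81 * 2 ^+ 9 + 109) * p ^+ 3 * r ^+ 7 + ((63 * 2 ^+ 8 + 177)) * 2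
    ^+ 1 * p ^+ 2 * r ^+ 8 + (39 * 2 ^+ 8 + 87) * p * r ^+ 9 + 227 * r ^+ 10
    + 6 * p ^+ 8 * y + 190 * p ^+ 7 * r * y + (5 * 2 ^+ 8 + 149) * p ^+ 6 * r
    ^+ 2 * y + ((9 * 2 ^+ 8 + 195)) * 2 ^+ 1 * p ^+ 5 * r ^+ 3 * y + (43 * 2
    ^+ 8 + 75) * p ^+ 4 * r ^+ 4 * y + ((2 ^+ 11 + 241)) * 2 ^+ 3 * p ^+ 3 *
    r ^+ 5 * y + ((19 * 2 ^+ 8 + 179)) * 2 ^+ 2 * p ^+ 2 * r ^+ 6 * y + 339 *
    2 ^+ 5 * p * r ^+ 7 * y + 381 * 2 ^+ 2 * r ^+ 8 * y) _ _).
  by ring: hy.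
have S4 : g ^+ 4 + 6 * g ^+ 2 * O2 + O2 ^+ 2 =
    (2 ^+ 9 + 65) * p ^+ 8 + 112 * p ^+ 7 * r + 112 * p ^+ 6 * r ^+ 2 - 15 *
    2 ^+ 6 * p ^+ 5 * r ^+ 3 - 29 * 2 ^+ 5 * p ^+ 4 * r ^+ 4 + 256 * p ^+ 3 *
    r ^+ 5 - 256 * p ^+ 2 * r ^+ 6 + 2 ^+ 10 * p * r ^+ 7 + 256 * r ^+ 8 -
    272 * p ^+ 6 * y + 9 * 2 ^+ 6 * p ^+ 5 * r * y - 15 * 2 ^+ 6 * p ^+ 4 * r
    ^+ 2 * y - 2 ^+ 9 * p ^+ 3 * r ^+ 3 * y + 256 * p ^+ 2 * r ^+ 4 * y + 2
    ^+ 10 * p * r ^+ 5 * y + 2 ^+ 10 * r ^+ 6 * y.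
  rewrite g4 g2 /O2 /f2 /al.
  apply: (@modulo (
    7 * p ^+ 7 * r + 52 * p ^+ 6 * r ^+ 2 + 196 * p ^+ 5 * r ^+ 3 + 472 * p
    ^+ 4 * r ^+ 4 + 49 * 2 ^+ 4 * p ^+ 3 * r ^+ 5 + 417 * 2 ^+ 1 * p ^+ 2 * r
    ^+ 6 + 448 * p * r ^+ 7 + 62 * r ^+ 8 + 2 * p ^+ 6 * y + 21 * p ^+ 5 * r
    * y + 106 * p ^+ 4 * r ^+ 2 * y + 277 * p ^+ 3 * r ^+ 3 * y + 421 * p ^+
    2 * r ^+ 4 * y + 342 * p * r ^+ 5 * y + 106 * r ^+ 6 * y) _ _).
  by ring: hy.
rewrite S0 S2 S4 pref.
(* [w] is the constant term of theta^16 without the eta factor. *)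
set w := (X in _ * X = _).
have -> : w =
    p ^+ 15 + 85 * 2 ^+ 3 * p ^+ 14 * r + 165 * 2 ^+ 2 * p ^+ 13 * r ^+ 2 +
    53 * 2 ^+ 4 * p ^+ 11 * r ^+ 4 - 384 * p ^+ 10 * r ^+ 5 + 9 * 2 ^+ 6 * p
    ^+ 9 * r ^+ 6 + 3 * 2 ^+ 8 * p ^+ 7 * r ^+ 8 + 2 ^+ 10 * p ^+ 5 * r ^+ 10
    + 240 * p ^+ 13 * y - 320 * p ^+ 12 * r * y + 2 ^+ 10 * p ^+ 11 * r ^+ 2
    * y - 3 * 2 ^+ 8 * p ^+ 10 * r ^+ 3 * y - 256 * p ^+ 9 * r ^+ 4 * y.
  rewrite /w /al; apply: (@modulo (
    p ^+ 14 * r + 28 * p ^+ 13 * r ^+ 2 + 3 * p ^+ 12 * r ^+ 3 + 153 * p ^+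
    11 * r ^+ 4 - 31 * p ^+ 10 * r ^+ 5 + 125 * p ^+ 9 * r ^+ 6 - 205 * p ^+
    8 * r ^+ 7 - 202 * p ^+ 7 * r ^+ 8 - 136 * p ^+ 6 * r ^+ 9 - 266 * p ^+ 5
    * r ^+ 10 + 312 * p ^+ 4 * r ^+ 11 - 16 * p ^+ 3 * r ^+ 12 + 256 * p ^+ 2
    * r ^+ 13 + 64 * p * r ^+ 14 - 9 * p ^+ 11 * r ^+ 2 * y + 35 * p ^+ 10 *
    r ^+ 3 * y - 109 * p ^+ 9 * r ^+ 4 * y + 154 * p ^+ 8 * r ^+ 5 * y - 307
    * p ^+ 7 * r ^+ 6 * y + 80 * p ^+ 6 * r ^+ 7 * y - 96 * p ^+ 5 * r ^+ 8 *
    y + 128 * p ^+ 4 * r ^+ 9 * y + 320 * p ^+ 3 * r ^+ 10 * y + 256 * p ^+ 2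
    * r ^+ 11 * y + 256 * p * r ^+ 12 * y) _ _).
  by ring: hy.
apply: (@modulo (
  2 * p ^+ 42 * r - 64 * p ^+ 41 * r ^+ 2 + 209 * p ^+ 40 * r ^+ 3 - (3 * 2
  ^+ 8 + 53) * p ^+ 39 * r ^+ 4 - 51 * p ^+ 38 * r ^+ 5 + 79 * p ^+ 37 * r ^+
  6 - ((2 ^+ 9 + 221)) * 2 ^+ 1 * p ^+ 36 * r ^+ 7 + (17 * 2 ^+ 8 + 173) * p
  ^+ 35 * r ^+ 8 - 213 * 2 ^+ 3 * p ^+ 34 * r ^+ 9 + 461 * p ^+ 33 * r ^+ 10
  + 9 * 2 ^+ 6 * p ^+ 32 * r ^+ 11 + 72 * p ^+ 31 * r ^+ 12 + 64 * p ^+ 30 *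
  r ^+ 13 + 128 * p ^+ 29 * r ^+ 14 + 2 ^+ 9 * p ^+ 28 * r ^+ 15 + 224 * p ^+
  27 * r ^+ 16 + 2 ^+ 9 * p ^+ 26 * r ^+ 17 + 128 * p ^+ 25 * r ^+ 18 + 22 *
  p ^+ 40 * r * y - 310 * p ^+ 39 * r ^+ 2 * y - (2 ^+ 9 + 55) * p ^+ 38 * r
  ^+ 3 * y + 254 * p ^+ 37 * r ^+ 4 * y - 9 * 2 ^+ 6 * p ^+ 36 * r ^+ 5 * y -
  147 * p ^+ 35 * r ^+ 6 * y + 37 * 2 ^+ 4 * p ^+ 34 * r ^+ 7 * y - 171 * 2
  ^+ 2 * p ^+ 33 * r ^+ 8 * y + 368 * p ^+ 32 * r ^+ 9 * y - 43 * 2 ^+ 4 * p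
  ^+ 31 * r ^+ 10 * y - 320 * p ^+ 30 * r ^+ 11 * y - 9 * 2 ^+ 6 * p ^+ 29 *
  r ^+ 12 * y + 2 ^+ 9 * p ^+ 28 * r ^+ 13 * y - 256 * p ^+ 27 * r ^+ 14 * y)
  _ _).
by ring: hy.
Qed.

End PolynomialCongruence.

(** * Elimination down to p, r and y *)

Section ThetaRelations.
(** [f], [a], [A], [p] are phi at q, q^2, q^4, q^8, and [s1], [s2], [s4], [s8] are psi at the same
    points. *)
Variables (R : comNzRingType) (q f a A p s1 s2 s4 s8 : R).
Hypotheses (hf : f = A + q * (2 * s4)) (ha : a = p + q ^+ 2 * (2 * s8)).
Hypotheses (hA : A ^+ 2 = p ^+ 2 + q ^+ 4 * (2 * s8) ^+ 2).
Hypotheses (h4 : s4 ^+ 2 = p * s8) (h1 : s1 ^+ 2 = a * s2) (h2 : s2 ^+ 2 = A * s4).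
Let r := q ^+ 2 * s8.
Let y := q * (A * s4).

(** s1^2 = a s2 removes [s1]. The powers of 2 s2 left over in E1, O1 and O2 are moved to the last
    factor of each summand, where s2^2 = A s4 turns them into [y]. *)
Lemma theta16_reduce :
  let E0 := f ^+ 2 * a + (2 * s1) ^+ 2 * q * (2 * s2) in
  let E1 := f ^+ 2 * (2 * s2) + (2 * s1) ^+ 2 * a in
  let k := 4 * f ^+ 2 * (2 * s1) ^+ 2 in
  let O0 := k * q * a * (2 * s2) in
  let O1 := k * (a ^+ 2 + q * (2 * s2) ^+ 2) in
  let O2 := k * a * (2 * s2) in
  let al := p + 2 * r in
  let f2 := al ^+ 2 + 4 * y in
  let e := al * (f2 + 8 * y) in
  let g := f2 + 2 * al ^+ 2 in
  let o0 := 32 * f2 * al ^+ 2 * y in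
  let o1 := 8 * f2 * al * (al ^+ 2 + 4 * y) in
  let o2 := 8 * f2 * al ^+ 2 in
  f ^+ 8 * a ^+ 20 * 
  ((E0 ^+ 4 + 6 * E0 ^+ 2 * O0 + O0 ^+ 2) *
    (A ^+ 2 * p + (2 * s4) ^+ 2 * (q ^+ 4 * (2 * s8))) +
  (6 * E0 ^+ 2 * E1 ^+ 2 + 6 * (E0 ^+ 2 * O2 + 2 * E0 * E1 * O1 + E1 ^+ 2 * O0) +
     (O1 ^+ 2 + 2 * O0 * O2)) *
    (A * (2 * s4) * (q ^+ 2 * p + q ^+ 4 * (2 * s8))) +
  (E1 ^+ 4 + 6 * E1 ^+ 2 * O2 + O2 ^+ 2) *
    (A ^+ 2 * (q ^+ 4 * (2 * s8)) + q ^+ 4 * (2 * s4) ^+ 2 * p)) =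
  f2 ^+ 4 * al ^+ 20 *
  ((e ^+ 4 + 6 * e ^+ 2 * o0 + o0 ^+ 2) * (p * (p ^+ 2 + 12 * r ^+ 2)) +
   (6 * e ^+ 2 * g ^+ 2 + 6 * (e ^+ 2 * o2 + 2 * e * g * o1 + g ^+ 2 * o0) +
      (o1 ^+ 2 + 2 * o0 * o2)) * (8 * al * y ^+ 2) +
   (g ^+ 4 + 6 * g ^+ 2 * o2 + o2 ^+ 2) *
     (32 * y ^+ 2 * r * (3 * p ^+ 2 + 4 * r ^+ 2))).
Proof.
move=> E0 E1 k O0 O1 O2 al f2 e g o0 o1 o2.
have aE : a = al by rewrite ha /al /r; ring.
have fE : f ^+ 2 = f2 by rewrite /f2 /al /y /r hf; ring: hA h4.
have s1E : (2 * s1) ^+ 2 = 4 * al * s2 by rewrite exprMn h1 aE; ring.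
have E0E : E0 = e by rewrite /E0 /e s1E fE aE /y; ring: h2.
have E1E : E1 = 2 * s2 * g by rewrite /E1 /g s1E fE aE; ring.
have O0E : O0 = o0 by rewrite /O0 /o0 /k s1E fE aE /y; ring: h2.
have O1E : O1 = 2 * s2 * o1 by rewrite /O1 /o1 /k s1E fE aE /y; ring: h2.
have O2E : O2 = (2 * s2) ^+ 2 * o2 by rewrite /O2 /o2 /k s1E fE aE; ring.
have t0E : A ^+ 2 * p + (2 * s4) ^+ 2 * (q ^+ 4 * (2 * s8)) =
    p * (p ^+ 2 + 12 * r ^+ 2) by rewrite /r; ring: hA h4.
have t2E : (2 * s2) ^+ 2 * (A * (2 * s4) * (q ^+ 2 * p + q ^+ 4 * (2 * s8))) =
    8 * al * y ^+ 2 by rewrite /al /r /y; ring: h2.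
have t4E : (2 * s2) ^+ 4 *
      (A ^+ 2 * (q ^+ 4 * (2 * s8)) + q ^+ 4 * (2 * s4) ^+ 2 * p) =
    32 * y ^+ 2 * r * (3 * p ^+ 2 + 4 * r ^+ 2).
  have -> : (2 * s2) ^+ 4 = 16 * (A * s4) ^+ 2 by rewrite -h2; ring.
  have -> : A ^+ 2 * (q ^+ 4 * (2 * s8)) + q ^+ 4 * (2 * s4) ^+ 2 * p =
      2 * q ^+ 2 * r * (3 * p ^+ 2 + 4 * r ^+ 2) by rewrite /r; ring: hA h4.
  by rewrite /y; ring.
rewrite (exprM f 2 4) fE aE E0E E1E O0E O1E O2E t0E -t2E -t4E.
congr (_ * _).
move: e g o0 o1 o2 {E0E E1E O0E O1E O2E t2E t4E} => e g o0 o1 o2; ring.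
Qed.

Lemma y_sqr : y ^+ 2 = p * r * (p ^+ 2 + 4 * r ^+ 2).
Proof. by rewrite /y /r; ring: hA h4. Qed.

End ThetaRelations.

(** * The eta factor modulo 2048 *)

Section Eta16.
Variables (R : comNzRingType) (q : R) (N : nat).
Hypotheses (q0 : q ^+ N = 0) (h2048 : 2 ^+ 11 = 0 :> R).

Lemma qpow0 k : (0 < k)%N -> (q ^+ k) ^+ N = 0.
Proof. by move=> k0; exact: expr_nil. Qed.

Lemma odd_unit (u v : R) : u = 1 + 2 * v -> u ^+ 1024 = 1.
Proof.
move=> ->; rewrite (_ : 1024%N = (2 ^ 10)%N) //.
by have [w ->] := char_expr_iter v 10; rewrite h2048 mul0r addr0.
Qed.

(** 2^10 (1 + 2v) = 2^10, as 2^11 = 0. *)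
Lemma odd_absorb (u v : R) k : u = 1 + 2 * v -> 2 ^+ 10 * u ^+ k = 2 ^+ 10.
Proof.
move=> ->; elim: k => [|k IHk]; first by rewrite mulr1.
by rewrite [_ ^+ k.+1]exprS mulrCA IHk mulrDl mul1r mulrAC -exprS h2048 mul0r addr0.
Qed.

Lemma phiN4_0 : (- q ^+ 4) ^+ N = 0.
Proof. by rewrite exprNn qpow0 // mulr0. Qed.

(** phi(-q^4)^1024 = 1 is inserted. [qinv16] uses 40 of its factors, and the other 984 form a series
    in q^4. *)
Lemma qinv16_mul X :
  qinv q N ^+ 16 * X = phi (- q ^+ 4) ^+ 984 * qinv (q ^+ 4) N ^+ 4 *
    (phi q ^+ 8 * phi (q ^+ 2) ^+ 20 * X).
Proof.
have [v /odd_unit e] := phi_odd phiN4_0.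
have -> : phi (- q ^+ 4) ^+ 984 * qinv (q ^+ 4) N ^+ 4 *
    (phi q ^+ 8 * phi (q ^+ 2) ^+ 20 * X) =
  phi (- q ^+ 4) ^+ 984 *
    (phi q ^+ 8 * phi (q ^+ 2) ^+ 20 * qinv (q ^+ 4) N ^+ 4) * X.
  by move: (phi (- q ^+ 4) ^+ 984) => *; ring.
rewrite -(qinv16 q0) mulrCA -exprD.
by rewrite (_ : (984 + 40 = 1024)%N) // e mulr1.
Qed.

Let p := phi (q ^+ 8).
Let r := q ^+ 2 * psi (q ^+ 8).
Let y := q * (phi (q ^+ 4) * psi (q ^+ 4)).
Let w := phi (- q ^+ 4) ^+ 984 * qinv (q ^+ 4) N ^+ 4.

(** The coefficient 2^10 absorbs every phi, also the two copies of phi(-q^4) that turn c(q^4)^4 into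
    c(q^8)^2. What remains has exponents 3 modulo 8. *)
Lemma top_term :
  w * (2 ^+ 10 * p ^+ 40 * r * y) =
  2 ^+ 10 * (qinv (q ^+ 8) N ^+ 2 * (q ^+ 3 * psi (q ^+ 4) * psi (q ^+ 8))).
Proof.
have [v1 /odd_absorb e1] := phi_odd phiN4_0.
have [v2 /odd_absorb e2] := phi_odd (@qpow0 4 isT).
have [v3 /odd_absorb e3] := phi_odd (@qpow0 8 isT).
have := qinv_phiN (@qpow0 4 isT); rewrite -exprM => <-.
have -> : w * (2 ^+ 10 * p ^+ 40 * r * y) =
  2 ^+ 10 * phi (- q ^+ 4) ^+ 984 * p ^+ 40 * phi (q ^+ 4) ^+ 1 *
    (qinv (q ^+ 4) N ^+ 4 * (q ^+ 3 * psi (q ^+ 4) * psi (q ^+ 8))).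
  rewrite /w /r /y; move: (phi (- q ^+ 4) ^+ 984) (p ^+ 40) => *; ring.
rewrite e1 e3 e2.
have -> : 2 ^+ 10 * ((qinv (q ^+ 4) N ^+ 2 * phi (- q ^+ 4)) ^+ 2 *
    (q ^+ 3 * psi (q ^+ 4) * psi (q ^+ 8))) =
  2 ^+ 10 * phi (- q ^+ 4) ^+ 2 *
    (qinv (q ^+ 4) N ^+ 4 * (q ^+ 3 * psi (q ^+ 4) * psi (q ^+ 8))) by ring.
by rewrite e1.
Qed.

Lemma eta16_theta :
  let E0 := phi (q ^+ 1) ^+ 2 * phi (q ^+ 2) + psi2 (q ^+ 1) ^+ 2 * q * psi2 (q ^+ 2) in
  let E1 := phi (q ^+ 1) ^+ 2 * psi2 (q ^+ 2) + psi2 (q ^+ 1) ^+ 2 * phi (q ^+ 2) in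
  let k := 4 * phi (q ^+ 1) ^+ 2 * psi2 (q ^+ 1) ^+ 2 in
  let O0 := k * q * phi (q ^+ 2) * psi2 (q ^+ 2) in
  let O1 := k * (phi (q ^+ 2) ^+ 2 + q * psi2 (q ^+ 2) ^+ 2) in
  let O2 := k * phi (q ^+ 2) * psi2 (q ^+ 2) in
  qinv q N ^+ 16 *
  ((E0 ^+ 4 + 6 * E0 ^+ 2 * O0 + O0 ^+ 2) *
    (phi (q ^+ 4) ^+ 2 * phi (q ^+ 8) + psi2 (q ^+ 4) ^+ 2 * (q ^+ 4 * psi2 (q ^+ 8))) +
  (6 * E0 ^+ 2 * E1 ^+ 2 + 6 * (E0 ^+ 2 * O2 + 2 * E0 * E1 * O1 + E1 ^+ 2 * O0) +
     (O1 ^+ 2 + 2 * O0 * O2)) *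
    (phi (q ^+ 4) * psi2 (q ^+ 4) * (q ^+ 2 * phi (q ^+ 8) + q ^+ 4 * psi2 (q ^+ 8))) +
  (E1 ^+ 4 + 6 * E1 ^+ 2 * O2 + O2 ^+ 2) *
    (phi (q ^+ 4) ^+ 2 * (q ^+ 4 * psi2 (q ^+ 8)) +
      q ^+ 4 * psi2 (q ^+ 4) ^+ 2 * phi (q ^+ 8))) =
  w * even_part p r + w * (2 ^+ 8 * p ^+ 41) * y +
  2 ^+ 10 * (qinv (q ^+ 8) N ^+ 2 * (q ^+ 3 * psi (q ^+ 4) * psi (q ^+ 8))).
Proof.
cbv zeta; rewrite !expr1 qinv16_mul.
rewrite (psi2E q0) (psi2E (@qpow0 2 isT)) (psi2E (@qpow0 4 isT)) (psi2E (@qpow0 8 isT)).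
have hf := phi_split q0; rewrite (psi2E (@qpow0 4 isT)) in hf.
have ha := phi_split (@qpow0 2 isT); rewrite -!exprM (psi2E (@qpow0 8 isT)) in ha.
have hA := phi_sqr (@qpow0 4 isT); rewrite -!exprM (psi2E (@qpow0 8 isT)) in hA.
have h4 := psi_sqr (@qpow0 4 isT); rewrite -!exprM in h4.
have h1 := psi_sqr q0.
have h2 := psi_sqr (@qpow0 2 isT); rewrite -!exprM in h2.
have := theta16_reduce hf ha hA h4 h1 h2; cbv zeta => ->.
have := theta16_mod2048 h2048 (y_sqr hA h4); cbv zeta => ->.
by rewrite mulrDr mulrDr top_term -/w [w * (_ * _)]mulrA.
Qed.

End Eta16.

(** * Truncated power series graded by residues of exponents *)

Section TruncatedSeries.
Variables (K : comNzRingType) (l : nat).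
Let R := {poly %/ 'X^(l.+1) : {poly K}}.
Implicit Types a b : R.

Definition tcoef (a : R) n : K := (a : {poly K})`_n.

Lemma tcoef_in n (P : {poly K}) : (n <= l)%N ->
  tcoef (in_qpoly 'X^(l.+1) P) n = P`_n.
Proof.
move=> le_n; rewrite /tcoef /= mk_monic_Xn.
by rewrite -Pdiv.RingMonic.take_poly_rmodp coef_take_poly ltnS le_n.
Qed.

Definition tX : R := in_qpoly 'X^(l.+1) 'X.

Lemma tXn_coef k n : (n <= l)%N -> tcoef (tX ^+ k) n = (n == k)%:R.
Proof. by move=> le_n; rewrite /tX -rmorphXn tcoef_in // coefXn. Qed.

Lemma tX_nil : tX ^+ l.+1 = 0.
Proof.
rewrite /tX -rmorphXn; apply: val_inj => /=.
by rewrite mk_monic_Xn Pdiv.RingMonic.rmodpp //; exact: monicXn.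
Qed.

Lemma tcoefM a b n : (n <= l)%N ->
  tcoef (a * b) n = \sum_(i < n.+1) tcoef a i * tcoef b (n - i).
Proof. by move=> le_n; rewrite -coefM -tcoef_in. Qed.

Lemma tcoefD a b n : tcoef (a + b) n = tcoef a n + tcoef b n.
Proof. by rewrite /tcoef poly_of_qpolyD coefD. Qed.

Definition tgraded d i (a : R) :=
  forall n, (n <= l)%N -> tcoef a n != 0 -> n = i %[mod d].

Lemma tgraded0 d i : tgraded d i 0.
Proof. by move=> n _; rewrite /tcoef coef0 eqxx. Qed.

Lemma tgradedX d k : tgraded d k (tX ^+ k).
Proof. by move=> n le_n; rewrite tXn_coef //; have [->|] := eqVneq n k; rewrite ?eqxx. Qed.

Lemma tgradedXd d k : (d %| k)%N -> tgraded d 0 (tX ^+ k).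
Proof. by move=> /eqP dk n le_n /tgradedX ->//; rewrite dk mod0n. Qed.

Lemma tgraded1 d : tgraded d 0 1.
Proof. by rewrite -(expr0 tX); apply: tgradedX. Qed.

Lemma tgradedD d i a b : tgraded d i a -> tgraded d i b -> tgraded d i (a + b).
Proof.
move=> ga gb n le_n; rewrite tcoefD; have [a0|/ga->//] := eqVneq (tcoef a n) 0.
by rewrite a0 add0r; exact: gb.
Qed.

Lemma tgradedN d i a : tgraded d i a -> tgraded d i (- a).
Proof.
by move=> ga n le_n; rewrite /tcoef raddfN coefN oppr_eq0; exact: ga.
Qed.

Lemma tgradedM d i j a b :
  tgraded d i a -> tgraded d j b -> tgraded d (i + j) (a * b).
Proof.
move=> ga gb n le_n; rewrite tcoefM // => nz.
have [/existsP[k /andP[ak bk]]|/existsPn no] :=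
    boolP [exists k : 'I_n.+1, (tcoef a k != 0) && (tcoef b (n - k) != 0)].
  have le_kn : (k <= n)%N by rewrite -ltnS.
  rewrite -{1}(subnKC le_kn) -modnDm (ga _ _ ak) ?(leq_trans le_kn) //.
  by rewrite (gb _ _ bk) ?modnDm // (leq_trans (leq_subr _ _)).
case/eqP: nz; apply: big1 => k _; have := no k; rewrite negb_and !negbK.
by case/orP=> /eqP->; rewrite ?mul0r ?mulr0.
Qed.

Lemma tgradedM0 d a b : tgraded d 0 a -> tgraded d 0 b -> tgraded d 0 (a * b).
Proof. exact: (@tgradedM d 0 0). Qed.

Lemma tgradedMl d i a b : tgraded d 0 a -> tgraded d i b -> tgraded d i (a * b).
Proof. exact: (@tgradedM d 0 i). Qed.

Lemma tgraded_exp d a k : tgraded d 0 a -> tgraded d 0 (a ^+ k).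
Proof.
move=> ga; elim: k => [|k IHk]; first exact: tgraded1.
by rewrite exprS; apply: tgradedM0.
Qed.

Lemma tgraded_nat d k : tgraded d 0 k%:R.
Proof.
elim: k => [|k IHk]; first exact: tgraded0.
by rewrite mulrS; apply: tgradedD => //; exact: tgraded1.
Qed.

Lemma tgraded_sum d i (I : Type) (s : seq I) (F : I -> R) :
  (forall j, tgraded d i (F j)) -> tgraded d i (\sum_(j <- s) F j).
Proof. by move=> gF; apply: big_ind; [exact: tgraded0|exact: tgradedD|]. Qed.

Lemma tgraded_gsum d i (F : int -> R) :
  (forall m, tgraded d i (F m)) -> tgraded d i (gsum F).
Proof. by move=> gF; apply: tgraded_sum. Qed.

Lemma tgraded_dvd d e a : (d %| e)%N -> tgraded e 0 a -> tgraded d 0 a.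
Proof. by move=> de ga n le_n /ga an; rewrite -(modn_dvdm n de) an // mod0n mod0n. Qed.

Lemma tgraded_phi d a : tgraded d 0 a -> tgraded d 0 (phi a).
Proof. by move=> ga; apply: tgraded_gsum => m; exact: tgraded_exp. Qed.

Lemma tgraded_psi d a : tgraded d 0 a -> tgraded d 0 (psi a).
Proof. by move=> ga; apply: tgraded_gsum => m; exact: tgraded_exp. Qed.

Lemma tgraded_qinv d a N : tgraded d 0 a -> tgraded d 0 (qinv a N).
Proof.
move=> ga; apply: big_ind; [exact: tgraded1|exact: tgradedM0|move=> i _].
by apply: tgraded_sum => j; do 2!apply: tgraded_exp.
Qed.

(** The exponents are 4k(k+1), and k(k+1) is even. *)
Lemma tgraded_psi4 : tgraded 8 0 (psi (tX ^+ 4)).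
Proof.
apply: tgraded_gsum => m; rewrite -exprM; apply: tgradedXd.
have := przE (2 * m); lia.
Qed.

Lemma tgraded_even_part a b : tgraded 2 0 a -> tgraded 2 0 b ->
  tgraded 2 0 (even_part a b).
Proof.
move=> ga gb; rewrite /even_part.
repeat match goal with
  | |- tgraded _ _ (_ + _) => apply: tgradedD
  | |- tgraded _ _ (- _) => apply: tgradedN
  | |- tgraded _ _ (_ * _) => apply: tgradedM0
  | |- tgraded _ _ (_ ^+ _) => apply: tgraded_exp
  | |- tgraded _ _ _%:R => exact: tgraded_nat
  | |- _ => assumption
  end.
Qed.

End TruncatedSeries.

(** * Coefficients at exponents 3 modulo 4 *)

Section Coefficients.
Variables (K : comNzRingType) (l : nat).
Hypothesis h2048 : 2 ^+ 11 = 0 :> K.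
Let R := {poly %/ 'X^(l.+1) : {poly K}}.
Let q : R := tX K l.

Lemma qpoly2048 : 2 ^+ 11 = 0 :> R.
Proof. by rewrite -(rmorph_nat (qpolyC _) 2) -rmorphXn h2048 rmorph0. Qed.

(** The first summand has even exponents and the second has exponents 1 modulo 4. Only [2 ^+ 10 * t]
    remains: doubling kills it, and it has no exponent 7 modulo 8. *)
Lemma tcoef_dissection (w e p y t : R) n : (n <= l)%N -> (n %% 4 = 3)%N ->
  tgraded 4 0 w -> tgraded 2 0 e -> tgraded 4 0 p -> tgraded 4 1 y ->
  tgraded 8 3 t ->
  let c := tcoef (w * e + w * p * y + 2 ^+ 10 * t) n in
  c * 2 = 0 /\ ((n %% 8 = 7)%N -> c = 0).
Proof.
move=> le_n n3 gw ge gp gy gt /=.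
have -> : tcoef (w * e + w * p * y + 2 ^+ 10 * t) n = tcoef (2 ^+ 10 * t) n.
  rewrite !tcoefD.
  have [->|/(tgradedM0 (tgraded_dvd (isT : 2 %| 4)%N gw) ge le_n)] :=
    eqVneq (tcoef (w * e) n) 0; last lia.
  have [->|/(tgradedMl (tgradedM0 gw gp) gy le_n)] :=
    eqVneq (tcoef (w * p * y) n) 0; last lia.
  by rewrite !add0r.
split=> [|n7].
  rewrite mulr_natr mulr2n -tcoefD.
  have -> : 2 ^+ 10 * t + 2 ^+ 10 * t = 2 ^+ 11 * t by ring.
  by rewrite qpoly2048 mul0r /tcoef coef0.
apply/eqP; apply: contraT.
have g2 : tgraded 8 0 (2 ^+ 10 : R) by apply: tgraded_exp; exact: tgraded_nat.
move/(tgradedMl g2 gt le_n); lia.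
Qed.

End Coefficients.

(** * Rows of generalized Frobenius partitions *)

Section Combinatorics.

(** The k-th power is a product over all colored integers, and choosing a term in each factor
    selects a row. *)
Lemma prod_row (S : comNzRingType) (a x : S) N k :
  (\prod_(j < N) (1 + a * x ^+ j)) ^+ k =
  \sum_(A : crow k N) a ^+ #|A| * x ^+ crow_sum A.
Proof.
transitivity (\prod_(u : 'I_N * 'I_k) (a * x ^+ u.1 + 1)).
  rewrite -(pair_bigA _ (fun (j : 'I_N) (_ : 'I_k) => a * x ^+ j + 1)) /= -prodrXl.
  by apply: eq_bigr => j _; rewrite prodr_const card_ord addrC.
rewrite bigA_distr; apply: eq_bigr => A _.
rewrite -big_mkcond /= big_split /= prodr_const; congr (_ * _).
by rewrite /crow_sum expr_sum.
Qed.

(** Entries are below [n] by [gfrob_entry_lt], so relabelling along [widen_ord] is a bijection. *)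
Lemma card_gfrob_widen k N n : (n <= N)%N -> #|gfrob k N n| = cphi k n.
Proof.
move=> le_nN.
pose v (u : 'I_n * 'I_k) := (widen_ord le_nN u.1, u.2).
have v_inj : injective v.
  by move=> [i c] [j d] [e ->]; congr pair; apply: val_inj.
pose g (AB : crow k n * crow k n) : crow k N * crow k N := (v @: AB.1, v @: AB.2).
have g_inj : injective g.
  by move=> [A B] [C D] [/(imset_inj v_inj) -> /(imset_inj v_inj) ->].
have gsE (A : crow k n) : crow_sum (v @: A) = crow_sum A.
  by rewrite /crow_sum big_imset //= => a b _ _; exact: v_inj.
rewrite /cphi -(card_imset _ g_inj); congr #|pred_of_set _|; apply/finset.setP => -[A B].
apply/idP/imsetP => [AB|[[C D] CD [-> ->]]]; last first.
  by move: CD; rewrite !inE /= !gsE !card_imset.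
have pre (C : crow k N) : C \subset A :|: B -> C = v @: (v @^-1: C).
  move=> sC; apply/finset.setP => -[i c]; apply/idP/imsetP => [iC|[u]].
    have lt_i := gfrob_entry_lt AB (fintype.subsetP sC _ iC).
    exists (Ordinal lt_i, c); last by congr pair; apply: val_inj.
    by rewrite inE /v /= (_ : widen_ord _ _ = i) //; apply: val_inj.
  by rewrite inE => uC ->.
have eA := pre A (finset.subsetUl _ _); have eB := pre B (finset.subsetUr _ _).
exists (v @^-1: A, v @^-1: B); last by rewrite /g /= -eA -eB.
by move: AB; rewrite {1}eA {1}eB !inE /= !gsE !card_imset.
Qed.

End Combinatorics.

(** * A model of Laurent polynomials with z^W = 1 *)

Section LaurentModel.
Variables (R : comNzRingType) (W : nat).
Hypothesis W0 : (0 < W)%N.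

(* The relation [z ^ W = 1] makes [z] invertible; it does not affect constant
   terms once [W] exceeds every exponent of [z] that occurs. *)
Let S := {poly %/ ('X^W - 1 : {poly R})}.
Let z : S := in_qpoly ('X^W - 1) 'X.

(** The quotient is by [mk_monic] of the modulus, which is a default value unless the modulus is
    monic and not constant. *)
Lemma mk_monic_Xn_sub_1 : mk_monic ('X^W - 1 : {poly R}) = 'X^W - 1.
Proof. by rewrite /mk_monic size_Xn_sub_1 // monic_Xn_sub_1 // ltnS W0. Qed.

Lemma zW : z ^+ W = 1.
Proof.
have e0 : in_qpoly ('X^W - 1 : {poly R}) ('X^W - 1) = 0.
  apply: val_inj; rewrite /= mk_monic_Xn_sub_1 Pdiv.RingMonic.rmodpp //.
  exact: monic_Xn_sub_1.
have := in_qpolyD ('X^W - 1) ('X^W - 1) (1 : {poly R}).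
by rewrite subrK e0 in_qpoly1 add0r /z -rmorphXn.
Qed.

Definition zpow (m : int) : S := z ^+ absz (modz m W%:Z).

Lemma zpow0 : zpow 0 = 1.
Proof. by rewrite /zpow mod0z. Qed.

Lemma zpowD m n : zpow (m + n) = zpow m * zpow n.
Proof.
have Wn0 : W%:Z != 0 by rewrite eqz_nat -lt0n.
have mk i : ((absz (modz i W%:Z))%:Z = modz i W%:Z) by rewrite gez0_abs // modz_ge0.
rewrite /zpow -exprD -[RHS](expr_mod _ zW); congr (_ ^+ _).
by apply/eqP; rewrite -eqz_nat -modz_nat PoszD !mk modzDm.
Qed.

Lemma zpowX m k : zpow m ^+ k = zpow (m * k%:Z).
Proof.
elim: k => [|k IHk]; first by rewrite mulr0 zpow0.
rewrite exprS IHk -zpowD; have -> : m + m * k%:Z = m * k.+1%:Z by lia.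
by [].
Qed.

Definition cterm (s : S) : R := (s : {poly R})`_0.

Fact cterm_is_additive : zmod_morphism cterm.
Proof. by move=> s t; rewrite /cterm /= coefB. Qed.

HB.instance Definition _ := GRing.isZmodMorphism.Build S R cterm cterm_is_additive.

Lemma ctermM a s : cterm (qpolyC _ a * s) = a * cterm s.
Proof.
have -> : qpolyC _ a = a *: (1 : S) by apply: val_inj; rewrite /= -alg_polyC.
by rewrite -scalerAl mul1r /cterm poly_of_qpolyZ coefZ.
Qed.

Lemma cterm_zpow m : cterm (zpow m) = (W %| `|m|)%N%:R.
Proof.
have Wn0 : W%:Z != 0 by rewrite eqz_nat -lt0n.
have lt_W : (absz (modz m W%:Z) < W)%N.
  by rewrite -ltz_nat gez0_abs ?modz_ge0 // ltz_pmod.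
rewrite /cterm /zpow /z -rmorphXn in_qpoly_small; last first.
  by rewrite mk_monic_Xn_sub_1 size_Xn_sub_1 // size_polyXn ltnS.
by rewrite coefXn eq_sym absz_eq0 -[(W %| `|m|)%N]/(W%:Z %| m)%Z (sameP dvdz_mod0P eqP).
Qed.

End LaurentModel.

(** * The generating function of cphi_16 *)

Section FrobeniusSeries.
Variables (K : comNzRingType) (n : nat).
Let R := {poly %/ 'X^(n.+1) : {poly K}}.
Let q : R := tX K n.
(** A multiple of 16 above 16(n+2), the bound in [ct_theta16], and so above every difference of row
    sizes, at most 16(n+1). *)
Let W := (16 * n.+3)%N.
Let f := qpolyC ('X^W - 1 : {poly R}).
Let h := zpow R W.

Let W0 : (0 < W)%N. Proof. by []. Qed.

Lemma tcoef_sum (I : Type) (s : seq I) (P : pred I) (F : I -> R) m :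
  tcoef (\sum_(i <- s | P i) F i) m = \sum_(i <- s | P i) tcoef (F i) m.
Proof.
by apply: (big_morph (fun a => tcoef a m)) => [a b|]; [exact: tcoefD|exact: coef0].
Qed.

Lemma zpow1f : (h 1 * f q) * h (-1) = f q.
Proof. by rewrite mulrAC -zpowD // subrr zpow0 mul1r. Qed.

(** The triple product at a = zq, b = 1/z. The exponent of z is m(m+1)/2 - m(m-1)/2 = m. *)
Lemma frobenius_theta :
  (\prod_(j < n.+1) (1 + (h 1 * f q) * f q ^+ j)) *
  (\prod_(j < n.+1) (1 + h (-1) * f q ^+ j)) =
  f (qinv q n.+1) * theta h (f q).
Proof.
have x0 : f q ^+ n.+1 = 0 by rewrite -rmorphXn tX_nil rmorph0.
have := @triple_product _ (h 1 * f q) (h (-1)) n.+1 (qinv (f q) n.+1).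
rewrite zpow1f => -> //; last exact: qinvK.
rewrite -rmorph_qinv; congr (_ * _); apply: eq_gsum => m.
rewrite /jmon exprMn mulrAC mulrC !(zpowX R W0) -zpowD //; congr (_ * zpow _ _ _).
by have := (triE m, triE (- m)); case; lia.
Qed.

(** Expanding both products gives a sum over pairs of rows. The constant term in z forces equal
    sizes, and the coefficient of q^n fixes the weight. *)
Lemma cphi_coef :
  (cphi 16 n)%:R = tcoef (qinv q n.+1 ^+ 16 * cterm (theta h (f q) ^+ 16)) n.
Proof.
rewrite -ctermM rmorphXn -exprMn -frobenius_theta exprMn !prod_row.
rewrite big_distrlr raddf_sum tcoef_sum /=.
transitivity (\sum_(A : crow 16 n.+1) \sum_(B : crow 16 n.+1)
    ((A, B) \in gfrob 16 n.+1 n)%:R : K).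
  rewrite pair_bigA -(card_gfrob_widen 16 (leqnSn n)) -sum1_card natr_sum.
  by rewrite [LHS]big_mkcond /=; apply: eq_bigr => -[A B] _ /=; case: ifP.
apply: eq_bigr => A _; rewrite raddf_sum tcoef_sum; apply: eq_bigr => B _ /=.
have cardW (C : crow 16 n.+1) : (#|C| <= n.+1 * 16)%N.
  by apply: leq_trans (max_card _) _; rewrite card_prod !card_ord.
have -> : (h 1 * f q) ^+ #|A| * f q ^+ crow_sum A * (h (-1) ^+ #|B| * f q ^+ crow_sum B) =
    f (q ^+ (#|A| + (crow_sum A + crow_sum B))) * h (#|A|%:Z - #|B|%:Z).
  have -> k : f (q ^+ k) = f q ^+ k by exact: rmorphXn.
  have hD m m' : h (m + m') = h m * h m' by exact: zpowD.
  have hX m k : h m ^+ k = h (m * k%:Z) by exact: zpowX.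
  rewrite exprMn !hX mul1r mulN1r hD !exprD.
  move: (h _) (h _) (f q ^+ _) (f q ^+ _) (f q ^+ _) => *; ring.
rewrite ctermM cterm_zpow // inE /=.
(* Unequal sizes differ by less than [W], so z^W = 1 creates no spurious constant term. *)
have [<-|neAB] := eqVneq #|A| #|B|.
  by rewrite subrr dvdn0 mulr1 tXn_coef.
have AW := cardW A; have BW := cardW B; rewrite gtnNdvd ?mulr0.
- by rewrite /tcoef coef0.
- by rewrite lt0n absz_eq0 subr_eq0 eqz_nat.
move: AW BW; rewrite /W; move: #|A| #|B| => a b; lia.
Qed.

Lemma cphi_mod (h2048 : 2 ^+ 11 = 0 :> K) : (n %% 4 = 3)%N ->
  (cphi 16 n)%:R * 2 = 0 :> K /\ ((n %% 8 = 7)%N -> (cphi 16 n)%:R = 0 :> K).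
Proof.
move=> n3; rewrite cphi_coef.
have W16 : (16 %| W)%N by exact: dvdn_mulr.
have Wbig : (16 * n.+2 < W)%N by rewrite /W; lia.
have q0 : q ^+ n.+1 = 0 := tX_nil K n.
have := @ct_theta16 R _ f (@cterm R W) h W (@ctermM R W) (zpowD R W0)
  (@zpow0 R W) (cterm_zpow R W0) W16 q n.+1 q0 Wbig.
cbv zeta => ->.
have := eta16_theta q0 (qpoly2048 n h2048); cbv zeta => ->.
have g4 k : (4 %| k)%N -> tgraded 4 0 (q ^+ k) := @tgradedXd K n 4 k.
have g8 k : (8 %| k)%N -> tgraded 8 0 (q ^+ k) := @tgradedXd K n 8 k.
have gp8 : tgraded 8 0 (phi (q ^+ 8)) by apply: tgraded_phi; exact: g8.
(* The five gradings: series in q^4, in q^2, in q^4, q times a series in q^4, and q^3 times a series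
   in q^8. *)
apply: (tcoef_dissection h2048 (leqnn n) n3).
- apply: tgradedM0; apply: tgraded_exp.
    by apply: tgraded_phi; apply: tgradedN; exact: g4.
  by apply: tgraded_qinv; exact: g4.
- apply: tgraded_even_part; first exact: tgraded_dvd gp8.
  apply: tgradedM0; first exact: tgradedXd.
  by apply: tgraded_psi; exact: tgradedXd.
- apply: tgradedM0; apply: tgraded_exp; first exact: tgraded_nat.
  exact: tgraded_dvd gp8.
- rewrite -(addn0 1%N); apply: tgradedM; first exact: (@tgradedX K n 4 1).
  by apply: tgradedM0; [apply: tgraded_phi|apply: tgraded_psi]; exact: g4.
apply: tgradedMl; first by apply: tgraded_exp; apply: tgraded_qinv; exact: g8.
rewrite -(addn0 3%N); apply: tgradedM; last by apply: tgraded_psi; exact: g8.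
by rewrite -(addn0 3%N); apply: tgradedM; [exact: tgradedX|exact: tgraded_psi4].
Qed.

End FrobeniusSeries.

(** * From Z/2048 to divisibility of integers *)

Lemma Z2048 : 2 ^+ 11 = 0 :> 'Z_(2 ^ 11).
Proof. by rewrite -natrX; exact: pchar_Zp. Qed.

Lemma Z2048_nat_eq0 n : n%:R = 0 :> 'Z_(2 ^ 11) -> (2 ^ 11 %| n)%N.
Proof. by move=> n0; have := val_Zp_nat (isT : 1 < 2 ^ 11)%N n; rewrite n0 => /esym/eqP. Qed.

Local Close Scope ring_scope.

Theorem theorem1p1 :
  (forall n : nat, cphi 16 (4 * n + 3) = 0 %[mod 1024]) /\
  (forall n : nat, cphi 16 (8 * n + 7) = 0 %[mod 2048]).
Proof.
split=> n; apply/eqP; rewrite mod0n.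
  have [] := @cphi_mod _ (4 * n + 3) Z2048; first lia.
  rewrite -natrM => /Z2048_nat_eq0 + _.
  (* 2^11 divides twice the count; one factor 2 cancels. *)
  rewrite (expnSr 2 10) dvdn_pmul2r //.
have [] := @cphi_mod _ (8 * n + 7) Z2048; first lia.
move=> _ e; apply: Z2048_nat_eq0; apply: e; lia.
Qed.
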